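(* Let $G$ be a planar graph without $5$-nets. (1) If $\Delta(G)\geq 6$, then $\chi'_{gl}(G)\leq \max\{8,\Delta(G)+1\}$. (2) If $\Delta(G)=5$ and $G$ contains no $4$-nets or $G$ contains no $6$-nets, then $\chi'_{gl}(G)\leq 7$.
   Context: All graphs are finite and simple; $\Delta(G)$ is the maximum degree of $G$. A $k$-net of a graph $G$ is a cycle of length $k$ in $G$ that has at least one chord in $G$. $\ell(G)$ denotes the line graph of $G$ (its vertices are the edges of $G$, two being adjacent iff they share an endpoint in $G$). Let $H$ be a graph with a fixed orientation of its edges, $A$ an Abelian group, $L:V(H)\to 2^A$ a list assignment and $f:E(H)\to A$. An $(A,L,f)$-coloring of $H$ is a map $c:V(H)\to A$ with $c(v)\in L(v)$ for every vertex $v$ and $c(x)-c(y)\neq f(xy)$ for every edge $xy$ directed from $x$ to $y$. $H$ is $(A,L)$-colorable if it has an $(A,L,f)$-coloring for every $f:E(H)\to A$ (this does not depend on the orientation). $H$ is $k$-group choosable if it is $(A,L)$-colorable for every Abelian group $A$ of order at least $k$ and every $L$ with $|L(v)|=k$ for all $v\in V(H)$. $\chi_{gl}(H)$ is the smallest $k$ such that $H$ is $k$-group choosable. $\chi'_{gl}(G)=\chi_{gl}(\ell(G))$. *)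

(* Defs.v *)
From HB Require Import structures.
From mathcomp Require Import all_boot all_order all_fingroup all_algebra.

Set Implicit Arguments.
Unset Strict Implicit.
Unset Printing Implicit Defensive.

Record sgraph := SGraph {
  vertex :> finType;
  adj : rel vertex;
  adj_sym : symmetric adj;
  adj_irr : irreflexive adj }.

Section Graphs.
Variable G : sgraph.

Definition degree (x : G) : nat := #|[set y | adj x y]|.

Definition max_degree : nat := \max_(x : G) degree x.

Definition edges : {set {set G}} :=
  [set e : {set G} | [exists x, exists y, adj x y && (e == [set x; y])]].

Definition edge : finType := {e : {set G} | e \in edges}.

(* A cycle is the cyclic sequence p of its (distinct) vertices; an edge of G
   joining two vertices of p is a chord if they are not consecutive on p. *)
Definition is_net (k : nat) (p : seq G) : Prop :=
  [/\ 2 < size p, size p = k, ucycle (@adj G) p &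
      exists x y, [/\ x \in p, y \in p, adj x y, y != next p x & x != next p y]].

Definition has_net (k : nat) : Prop := exists p : seq G, is_net k p.

Definition dart : finType := {d : G * G | adj d.1 d.2}.

Definition tail (d : dart) : G := (val d).1.

Lemma rev_dart_subproof (d : dart) : adj (val d).2 (val d).1.
Proof. by rewrite adj_sym; exact: (valP d). Qed.

Definition rev_dart (d : dart) : dart :=
  exist (fun d : G * G => adj d.1 d.2) ((val d).2, (val d).1)
        (rev_dart_subproof d).

(* s cyclically permutes the darts leaving each vertex: this records the
   circular order in which edges leave their endpoint in a drawing of G. *)
Definition rotation_system (s : {perm dart}) : Prop :=
  forall d d' : dart, fconnect s d d' = (tail d == tail d').

(* An isolated vertex carries no dart, but its component, drawn on its own
   sphere, has one face. *)
Definition num_faces (s : {perm dart}) : nat :=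
  fcard (s \o rev_dart) predT + #|[set x : G | degree x == 0]|.

(* G can be drawn without crossings: some rotation system embeds each
   component in its own sphere, i.e. has total genus 0. No rotation system
   exceeds Euler's bound V - E + F = 2 on any component, so the sum over the
   components is an equality only if every component has genus 0. *)
Definition planar : Prop :=
  exists2 s : {perm dart}, rotation_system s &
    #|G| + num_faces s = #|edges| + 2 * n_comp (@adj G) predT.

Definition line_adj : rel edge :=
  fun e e' => (e != e') && ~~ [disjoint val e & val e'].

Lemma line_adj_sym : symmetric line_adj.
Proof. by move=> e e'; rewrite /line_adj eq_sym disjoint_sym. Qed.

Lemma line_adj_irr : irreflexive line_adj.
Proof. by move=> e; rewrite /line_adj eqxx. Qed.

Definition line_graph : sgraph := SGraph line_adj_sym line_adj_irr.

Definition orientation (o : rel G) : Prop :=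
  (forall x y, o x y -> adj x y) /\ (forall x y, adj x y -> o x y = ~~ o y x).

End Graphs.

From mathcomp Require Import boolp classical_sets functions cardinality.
Local Open Scope classical_set_scope.
Local Open Scope card_scope.

Section GroupColoring.
Variable H : sgraph.

Definition group_coloring (o : rel H) (A : zmodType) (L : H -> set A)
    (f : edge H -> A) (c : H -> A) : Prop :=
  (forall v, L v (c v)) /\
  (forall (e : edge H) (x y : H),
     val e = [set x; y]%SET -> o x y -> (c x - c y)%R <> f e).

(* Reversing an edge xy amounts to replacing f(xy) by - f(xy), so that
   quantifying over all orientations is the same as fixing one. *)
Definition group_colorable (A : zmodType) (L : H -> set A) : Prop :=
  forall o : rel H, orientation o ->
  forall f : edge H -> A, exists c : H -> A, group_coloring o L f c.

Definition group_choosable (k : nat) : Prop :=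
  forall A : zmodType, `I_k #<= [set: A] ->
  forall L : H -> set A, (forall v, L v #= `I_k) -> group_colorable L.

Lemma group_choosable_card : group_choosable #|H|.
Proof.
move=> A _ L cardL o [o_adj o_asym] f.
pose g (u v : H) : A := if insub [set u; v]%SET is Some e then f e else 0%R.
pose ok (c : H -> A) (s : seq H) := (forall v, v \in s -> L v (c v)) /\
  (forall x y, x \in s -> y \in s -> o x y -> (c x - c y)%R <> g x y).
suff [c [cL cE]] : exists c, ok c (enum H).
  exists c; split=> [v|e x y exy oxy]; first by apply: cL; rewrite mem_enum.
  have := cE x y; rewrite !mem_enum => /(_ isT isT oxy).
  by rewrite /g -exy valK.
have oxx x : o x x = false.
  by apply/negP => /o_adj; rewrite adj_irr.
have : size (enum H) <= #|H| by rewrite -cardE.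
elim: (enum H) => [_|v s IHs /= lt_s]; first by exists (fun=> 0%R); split.
have [c [cL cE]] := IHs (ltnW lt_s).
have [vs|v_s] := boolP (v \in s).
  exists c; split=> [u|x y]; rewrite !inE.
    by case/predU1P=> [->|]; apply: cL.
  by move=> /predU1P[->|xs] /predU1P[->|ys]; apply: cE.
pose bad := [seq if o u v then (c u - g u v)%R else (c u + g v u)%R | u <- s].
have [a La abad] : exists2 a, L v a & a \notin bad.
  apply: contrapT => no_a.
  pose pA : pointedType := HB.pack (GRing.Zmodule.sort A) (Choice.class A)
    (isPointed.Build A 0%R).
  have [h [hI hinj _]] := @card_set_bijP _ pA _ _ (card_esym (cardL v)).
  have : size [seq h i | i <- iota 0 #|H|] <= size bad.
    apply: uniq_leq_size.
      rewrite map_inj_in_uniq ?iota_uniq // => i j.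
      rewrite !mem_iota /= => iH jH; apply: hinj; exact/mem_set.
    move=> b /mapP[i]; rewrite mem_iota /= => iH ->.
    apply/negPn/negP => hbad; apply: no_a; exists (h i) => //.
    exact: hI.
  by rewrite !size_map size_iota leqNgt lt_s.
exists (fun u => if u == v then a else c u); split=> [u|x y]; rewrite !inE.
  by have [->//|_ /=] := eqVneq u v; apply: cL.
have [->|xv] := eqVneq x v; have [->|yv] := eqVneq y v => //=.
- by rewrite oxx.
- move=> _ ys ovy E; case/negP: abad; apply/mapP; exists y => //.
  have := o_asym _ _ (o_adj _ _ ovy); rewrite ovy => /esym/negPf ->.
  by rewrite -E GRing.addrC GRing.subrK.
- move=> xs _ oxv E; case/negP: abad; apply/mapP; exists x => //.
  by rewrite oxv -E GRing.opprB GRing.addrC GRing.subrK.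
- by move=> xs ys; apply: cE.
Qed.

Lemma ex_group_choosable : exists k, `[< group_choosable k >].
Proof. by exists #|H|; apply/asboolP; exact: group_choosable_card. Qed.

Definition group_choice_number : nat := ex_minn ex_group_choosable.

End GroupColoring.

Definition edge_group_choice_number (G : sgraph) : nat :=
  group_choice_number (line_graph G).

(* Main.v *)
Require Import Defs.
From mathcomp Require Import boolp classical_sets functions cardinality.
From mathcomp Require Import all_fingroup all_algebra zify.
From mathcomp Require Import all_boot.

(**
The number of colours is written [k]; it is [D + 1] with [D = max (7, Delta)] in
the first part and 7 in the second. Consider a graph with the fewest edges among
those whose edges cannot be coloured.

An edge [xy] meets [deg x + deg y - 2] others, so it could be coloured last if
this number were less than [k]: every edge satisfies [deg x + deg y >= k + 2].
Isolated vertices aside, all degrees are at least 3 in the first part, and the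
neighbours of a vertex of degree 3 have degree [D]; in the second part all degrees
are 4 or 5, and vertices of degree 4 are pairwise non-adjacent.

In the first part, moreover, no cycle alternates between vertices of degree 3
and vertices of degree [D] ([reducible_alternating_cycle]). Uncolour all edges at
the vertices of degree 3 of such a cycle. Each of them meets exactly [k] edges, so
it keeps at least as many colours as it has uncoloured neighbours, and the greedy
procedure only fails at the very last edge [sa]. It is rescued by first colouring
two disjoint edges at [s] and at [a] so that together they forbid at most one
colour of [sa] ([degree_colorable]). Without alternating cycles there are at most
as many vertices of degree 3 as vertices of degree [D] ([card_degree3_le]).

Planarity is inherited from the given graph ([planar_del]): for a rotation system,
[V - E + F - 2c] does not increase when an edge is added, and it is 0 both without
edges and for the planar graph itself. This leads to a contradiction by
discharging. In an embedding give [deg v - 4] to each vertex [v] and the length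
minus 4 to each face; by Euler's formula the total is negative ([euler_lt]). Only
triangles and vertices of degree 3 are in debt, for one unit each. Three
consecutive triangles around a vertex of degree at least 4 would form a 5-net, so
at most two thirds of the corners at such a vertex are triangular ([tri_at_no5]);
a vertex of degree 5 can thus give 1/3, and a vertex of degree at least 6 can give
1/2, to each of its triangles. By the condition on the edges this pays for all
triangles, and vertices of degree [D] keep one unit, which pays for the vertices
of degree 3 ([discharge_large]). When all degrees are 4 or 5 every triangle has
two corners of degree 5. Without 4-nets triangles share no edge and a vertex of
degree 5 can give 1/2 to each. Without 6-nets the face across an edge of a
triangle is a triangle or has length at least 6; such a long face can give 1/3
across each edge, and every triangle borders at most one other triangle, so that
the vertices have little left to pay ([discharge_small]).
*)

Set Implicit Arguments.
Unset Strict Implicit.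
Unset Printing Implicit Defensive.

(** * Colouring from lists with forbidden differences *)

Section ListColoring.

Variables (A : zmodType) (T : finType) (r : rel T) (g : T -> T -> A).
Hypotheses (r_sym : symmetric r) (r_irr : irreflexive r).
Hypothesis g_anti : forall x y, r x y -> (g y x = - g x y)%R.

(** Since [g y x = - g x y], the constraint on a pair of neighbours is the same
read from either side; no orientation has to be chosen. *)
Definition proper (L : T -> seq A) (S : {set T}) (c : T -> A) :=
  (forall x, x \in S -> c x \in L x) /\
  (forall x y, x \in S -> y \in S -> r x y -> c x <> (c y + g x y)%R).

Definition nbrs (S : {set T}) (x : T) := [set y in S | r x y].

Lemma conflict_sym x y (a b : A) :
  r x y -> (a = b + g x y)%R -> (b = a + g y x)%R.
Proof. by move=> rxy ->; rewrite (g_anti rxy) GRing.addrK. Qed.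

(** The new vertex loses at most one colour for each element of [N], a set of
representatives of the colours actually forbidden in its list; [N] can be smaller
than the neighbourhood when two neighbours forbid the same colour. *)
Lemma proper_extend L S c x (N : {set T}) :
    proper L S c -> uniq (L x) -> #|N| < size (L x) ->
    (forall y, y \in nbrs S x -> (c y + g x y)%R \in L x ->
       exists2 z, z \in N & (c y + g x y = c z + g x z)%R) ->
  exists2 c', proper L (x |: S) c' & {in S :\ x, c' =1 c}.
Proof.
move=> [cL cP] uL ltN hN.
pose B := [seq (c z + g x z)%R | z <- enum N].
have [a aL aB] : exists2 a, a \in L x & a \notin B.
  have [/hasP[a aL aB]|] := boolP (has (fun a => a \notin B) (L x)).
    by exists a.
  rewrite -all_predC => /allP h.
  have : size (L x) <= size B.
    by apply: uniq_leq_size => // a /h /=; rewrite negbK.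
  by rewrite size_map -cardE leqNgt ltN.
have aP y : y \in S -> r x y -> a <> (c y + g x y)%R.
  move=> yS rxy ea; case/negP: aB.
  have [|| z zN ez] := hN y; first by rewrite inE yS.
    by rewrite -ea.
  by apply/mapP; exists z; rewrite ?mem_enum // -ez.
exists (fun z => if z == x then a else c z).
  split=> [y|y z]; rewrite !inE.
    by case: eqP => [-> //|_ /=]; apply: cL.
  have [->|nyx] := eqVneq y x; have [->|nzx] := eqVneq z x => //=.
  - by rewrite r_irr.
  - by move=> _ zS rxz; apply: aP.
  - move=> yS _ ryx /(conflict_sym ryx); apply: aP => //.
    by rewrite r_sym.
  - by apply: cP.
by move=> y; rewrite !inE => /andP[/negPf->].
Qed.

Lemma proper_greedy L S c x :
    proper L S c -> uniq (L x) -> #|nbrs S x| < size (L x) ->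
  exists2 c', proper L (x |: S) c' & {in S :\ x, c' =1 c}.
Proof.
move=> pc uL ltN; apply: (proper_extend pc uL ltN) => y yN _.
by exists y.
Qed.

(** Colour by decreasing rank: each vertex other than [e] then still has an
uncoloured neighbour, hence a free colour in a list as long as its degree. *)
Lemma proper_ranked L (U : {set T}) e (rk : T -> nat) (S : {set T}) c :
    (forall x, x \in U -> uniq (L x)) ->
    (forall x, x \in U -> #|nbrs U x| <= size (L x)) ->
    S \subset U :\ e ->
    (forall x, x \in (U :\: S) :\ e ->
       exists2 y, y \in U :\: S & r x y && (rk y < rk x)) ->
    proper L S c ->
  exists2 c', proper L (U :\ e) c' & {in S, c' =1 c}.
Proof.
move=> uL dL; have [n] := ubnP #|U :\: S|.
elim: n => // n IHn in S c *; rewrite ltnS => leSn sSU rkP pc.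
have [x0 x0P|noW] := pickP (mem ((U :\: S) :\ e)); last first.
  exists c => //; suff -> : U :\ e = S by [].
  apply/eqP; rewrite eqEsubset sSU andbT; apply/subsetP => x xU.
  by have := noW x; move: xU; rewrite !inE; case: (x \in S) => //= ->.
have [x xW xmax] := arg_maxnP rk x0P.
have [y yW /andP[rxy lt_yx]] := rkP x xW.
move: (xW); rewrite !inE => /and3P[xe xS xU].
have [|c1 pc1 c1S] := proper_greedy pc (uL _ xU).
  apply: leq_trans (dL _ xU); apply: proper_card; apply/properP; split.
    apply/subsetP => z; rewrite !inE => /andP[zS ->].
    by have /subsetP/(_ z zS) := sSU; rewrite !inE => /andP[_ ->].
  by move: yW; rewrite inE => /andP[yS yU]; exists y; rewrite !inE ?yU // (negPf yS).
have sxSU : x |: S \subset U :\ e.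
  by rewrite subUset sub1set sSU !inE xe xU.
have [||c2 pc2 c2S] := IHn (x |: S) c1 _ sxSU _ pc1.
- apply: leq_trans leSn; apply: proper_card; apply/properP; split.
    by apply: setDS; apply: subsetUr.
  by exists x; rewrite !inE ?eqxx ?xS ?xU.
- move=> z; rewrite !inE negb_or => /andP[ze /andP[/andP[zx zS] zU]].
  have zW : z \in (U :\: S) :\ e by rewrite !inE ze zS zU.
  have [w wW /andP[rzw lt_wz]] := rkP z zW.
  exists w; last by rewrite rzw.
  move: wW; rewrite !inE negb_or => /andP[-> ->]; rewrite !andbT.
  apply/eqP => wx; move: lt_wz; rewrite wx ltnNge.
  by have /= -> := xmax z zW.
exists c2 => // z zS; rewrite c2S ?inE ?zS ?orbT // c1S // !inE zS andbT.
by apply: contraNneq xS => <-.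
Qed.

(** Greedy colouring by decreasing rank only gets stuck at the last vertex [e],
all of whose neighbours are coloured. If the list of [e] is longer than its
degree, it does not. Otherwise colour two non-adjacent neighbours [e1] and [e2] of
[e] first, so that together they forbid at most one colour of [e]: the lists of
[e1] and [e2] are together longer than that of [e], so the colours that they
forbid at [e] cannot all be distinct elements of it. *)
Lemma degree_colorable L (U : {set T}) e e1 e2 (rk : T -> nat) :
    (forall x, x \in U -> uniq (L x)) ->
    (forall x, x \in U -> #|nbrs U x| <= size (L x)) ->
    e \in U -> e1 \in nbrs U e -> e2 \in nbrs U e -> e1 != e2 -> ~~ r e1 e2 ->
    #|nbrs U e| < #|nbrs U e1| + #|nbrs U e2| ->
    (forall x, x \in (U :\: [set e1; e2]) :\ e ->
       exists2 y, y \in U :\: [set e1; e2] & r x y && (rk y < rk x)) ->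
  exists c, proper L U c.
Proof.
move=> uL dL eU; rewrite !inE => /andP[e1U re1] /andP[e2U re2] ne12 nr12 ltd rkP.
have ne1e : e1 != e by apply: contraTneq re1 => ->; rewrite r_irr.
have ne2e : e2 != e by apply: contraTneq re2 => ->; rewrite r_irr.
have [c1 [c2 [c1L c2L good]]] : exists c1 c2 : A, [/\ c1 \in L e1, c2 \in L e2 &
    [\/ (c1 + g e e1 = c2 + g e e2)%R, (c1 + g e e1)%R \notin L e,
      (c2 + g e e2)%R \notin L e | #|nbrs U e| < size (L e)]].
  have nonempty z : z \in U -> r e z -> exists a, a \in L z.
    move=> zU rez; have : 0 < size (L z).
      apply: leq_trans (dL _ zU); rewrite card_gt0; apply/set0Pn; exists e.
      by rewrite !inE eU r_sym.
    by case: (L z) => // a l _; exists a; rewrite mem_head.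
  have [a1 a1L] := nonempty _ e1U re1; have [a2 a2L] := nonempty _ e2U re2.
  pose sh z := [seq (a + g e z)%R | a <- L z].
  have usize z : z \in U -> uniq (sh z).
    by move=> zU; rewrite map_inj_uniq ?uL //; apply: GRing.addIr.
  have [lt_e|ge_e] := ltnP #|nbrs U e| (size (L e)).
    by exists a1, a2; split=> //; apply: Or44.
  have [/hasP[_ /mapP[a aL ->] aN]|/hasPn all1] :=
      boolP (has (fun a => a \notin L e) (sh e1)).
    by exists a, a2; split=> //; apply: Or42.
  have [/hasP[_ /mapP[a aL ->] aN]|/hasPn all2] :=
      boolP (has (fun a => a \notin L e) (sh e2)).
    by exists a1, a; split=> //; apply: Or43.
  have [/hasP[b /mapP[a2' a2'L ->] /mapP[a1' a1'L eq12]]|disj] :=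
      boolP (has (mem (sh e1)) (sh e2)).
    by exists a1', a2'; split=> //; apply: Or41.
  have : size (sh e1 ++ sh e2) <= size (L e).
    apply: uniq_leq_size; first by rewrite cat_uniq !usize ?disj.
    by move=> a; rewrite mem_cat => /orP[/all1|/all2]; rewrite negbK.
  rewrite size_cat !size_map => le12.
  have := leq_trans ltd (leq_add (dL _ e1U) (dL _ e2U)).
  by rewrite ltnNge (leq_trans le12 ge_e).
pose c0 z := if z == e1 then c1 else c2.
have ne21 : (e2 == e1) = false by rewrite eq_sym (negPf ne12).
have pc0 : proper L [set e1; e2] c0.
  split=> [x|x y]; rewrite !inE /c0.
    by case/orP=> /eqP->; rewrite ?eqxx ?ne21.
  by case/orP=> /eqP->; case/orP=> /eqP->; rewrite ?r_irr ?(negPf nr12) // r_sym (negPf nr12).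
have s0U : [set e1; e2] \subset U :\ e.
  by rewrite subUset !sub1set !inE ne1e e1U ne2e.
have [c pc cS] := proper_ranked uL dL s0U rkP pc0.
have ce1 : c e1 = c1 by rewrite cS ?inE ?eqxx // /c0 eqxx.
have ce2 : c e2 = c2 by rewrite cS ?inE ?eqxx ?orbT // /c0 ne21.
have nb1 : e1 \in nbrs U e by rewrite inE e1U.
have nb2 : e2 \in nbrs U e by rewrite inE e2U.
have ltU z : z \in nbrs U e -> #|nbrs U e :\ z| < size (L e).
  by move=> zN; apply: leq_trans (dL _ eU); rewrite (cardsD1 z (nbrs U e)) zN.
have subN y : y \in nbrs (U :\ e) e -> y \in nbrs U e.
  by rewrite !inE => /andP[/andP[_ ->] ->].
suff [N ltN hN] : exists2 N : {set T}, #|N| < size (L e) &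
    forall y, y \in nbrs (U :\ e) e -> (c y + g e y)%R \in L e ->
    exists2 z, z \in N & (c y + g e y = c z + g e z)%R.
  have [c' pc' _] := proper_extend pc (uL _ eU) ltN hN.
  by exists c'; rewrite setD1K in pc'.
case: good => [eq12|out1|out2|lt_e].
- exists (nbrs U e :\ e2); first exact: ltU.
  move=> y /subN yN _; have [->|ny2] := eqVneq y e2.
    by exists e1; rewrite ?in_setD1 ?ne12 // ce1 ce2.
  by exists y; rewrite // in_setD1 ny2.
- exists (nbrs U e :\ e1); first exact: ltU.
  move=> y /subN yN; have [->|ny1 _] := eqVneq y e1.
    by rewrite ce1 (negPf out1).
  by exists y; rewrite // in_setD1 ny1.
- exists (nbrs U e :\ e2); first exact: ltU.
  move=> y /subN yN; have [->|ny2 _] := eqVneq y e2.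
    by rewrite ce2 (negPf out2).
  by exists y; rewrite // in_setD1 ny2.
- by exists (nbrs U e) => // y /subN yN _; exists y.
Qed.

Definition residual (L : T -> seq A) (S : {set T}) (c : T -> A) x :=
  [seq a <- L x | [forall y in nbrs S x, a != c y + g x y]%R].

Lemma size_residual (L : T -> seq A) (S : {set T}) (c : T -> A) x :
  uniq (L x) -> size (L x) <= size (residual L S c x) + #|nbrs S x|.
Proof.
move=> uL; pose free := [pred a | [forall y in nbrs S x, a != c y + g x y]%R].
rewrite /residual size_filter -(count_predC free (L x)) leq_add2l -size_filter.
rewrite cardE -(size_map (fun y => c y + g x y)%R).
apply: uniq_leq_size; first exact: filter_uniq.
move=> a; rewrite mem_filter /= => /andP[].
rewrite negb_forall => /existsP[y]; rewrite negb_imply negbK => /andP[yN /eqP->] _.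
by apply/mapP; exists y; rewrite ?mem_enum.
Qed.

Lemma proper_residual L S U c d :
    proper L S c -> proper (residual L S c) U d ->
  proper L (S :|: U) (fun x => if x \in U then d x else c x).
Proof.
move=> [cL cP] [dL dP].
have dc x y : x \in U -> y \in S -> r x y -> d x <> (c y + g x y)%R.
  move=> xU yS rxy; have := dL x xU; rewrite mem_filter => /andP[/forallP h _].
  by have /implyP/(_ _)/eqP := h y; apply; rewrite inE yS.
split=> [x|x y]; rewrite !inE.
  case: ifP => [/dL + _|_]; last by rewrite orbF; apply: cL.
  by rewrite mem_filter => /andP[].
case: (boolP (x \in U)) => xU; case: (boolP (y \in U)) => yU; rewrite ?orbT ?orbF.
- by move=> _ _; apply: dP.
- by move=> _ yS; apply: dc.
- move=> xS _ rxy /(conflict_sym rxy); apply: dc => //; by rewrite r_sym.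
- exact: cP.
Qed.

End ListColoring.
(** * Choosability of edge sets and reducible configurations *)

Lemma card_eq_seq (T : eqType) (S : set T) n :
    (S #= `I_n)%card ->
  exists s : seq T, [/\ uniq s, size s = n & forall x, x \in s -> S x].
Proof.
elim: n S => [|n IHn] S; first by exists nil.
case/eq_cardSP=> x Sx /IHn[s [us ss sS]]; exists (x :: s); split=> //=.
- by rewrite us andbT; apply/negP => /sS[_]; apply.
- by rewrite ss.
- by move=> y; rewrite inE => /predU1P[->|/sS[]].
Qed.

Section EdgeChoosability.

Variable V : finType.
Implicit Types (e f : {set V}) (E U : {set {set V}}).

Definition touches e f := (e != f) && ~~ [disjoint e & f].

Lemma touches_sym : symmetric touches.
Proof. by move=> e f; rewrite /touches eq_sym disjoint_sym. Qed.

Lemma touches_irr : irreflexive touches.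
Proof. by move=> e; rewrite /touches eqxx. Qed.

(** Choosability of a line graph, for a set of edges of a graph on [V]: deleting
edges changes neither the type of the edges nor that of the lists. *)
Definition edge_choosable k E :=
  forall (A : zmodType) (g : {set V} -> {set V} -> A) (L : {set V} -> seq A),
    (forall e f, touches e f -> (g f e = - g e f)%R) ->
    (forall e, e \in E -> uniq (L e) /\ size (L e) = k) ->
  exists c, proper touches g L E c.

Lemma edge_choosable0 k : edge_choosable k set0.
Proof. by move=> A g L _ _; exists (fun=> 0%R); split=> [x|x y]; rewrite inE. Qed.

Lemma reducible_edge k E e :
    e \in E -> #|nbrs touches E e| < k ->
  edge_choosable k (E :\ e) -> edge_choosable k E.
Proof.
move=> eE lt_k chE A g L g_anti LE.
have [|c pc] := chE A g L g_anti; first by move=> f /setD1P[_ /LE].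
have [||c' pc' _] := proper_greedy touches_sym touches_irr g_anti pc (x := e).
- by have [] := LE e eE.
- have [_ ->] := LE e eE; apply: leq_ltn_trans lt_k; apply: subset_leq_card.
  by apply/subsetP => f; rewrite !inE => /andP[/andP[_ ->] ->].
- by exists c'; rewrite setD1K in pc'.
Qed.

Lemma nbrs_setU E U e :
  nbrs touches (E :|: U) e = nbrs touches E e :|: nbrs touches U e.
Proof. by apply/setP => f; rewrite !inE andb_orl. Qed.

(** [degree_colorable] on a set [U] of edges meeting at most [k] others, after
the rest has been coloured: each element of [U] loses one colour per coloured
neighbour, which leaves it at least as many colours as neighbours in [U]. *)
Lemma reducible_set k E U e e1 e2 (rk : {set V} -> nat) :
    U \subset E -> (forall f, f \in U -> #|nbrs touches E f| <= k) ->
    e \in U -> e1 \in nbrs touches U e -> e2 \in nbrs touches U e ->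
    e1 != e2 -> ~~ touches e1 e2 ->
    #|nbrs touches U e| < #|nbrs touches U e1| + #|nbrs touches U e2| ->
    (forall f, f \in (U :\: [set e1; e2]) :\ e ->
       exists2 h, h \in U :\: [set e1; e2] & touches f h && (rk h < rk f)) ->
  edge_choosable k (E :\: U) -> edge_choosable k E.
Proof.
move=> sUE dU eU e1N e2N ne12 nm12 ltd rkP chE A g L g_anti LE.
have [|c pc] := chE A g L g_anti; first by move=> f /setDP[/LE].
pose R := residual touches g L (E :\: U) c.
have [f fU|f fU|d pd] := degree_colorable (L := R) touches_sym touches_irr g_anti
    _ _ eU e1N e2N ne12 nm12 ltd rkP.
- by have [uL _] := LE f (subsetP sUE f fU); apply: filter_uniq.
- have [uL sL] := LE f (subsetP sUE f fU).
  rewrite -(leq_add2r #|nbrs touches (E :\: U) f|).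
  apply: leq_trans (size_residual _ _ _ _ uL); rewrite sL.
  apply: leq_trans (dU f fU); rewrite -{2}(setID E U) (setIidPr sUE) nbrs_setU.
  rewrite cardsU; set X := _ :&: _; suff -> : X = set0 by rewrite cards0 subn0.
  apply/setP => h; rewrite !inE; case: (h \in U); rewrite ?andbF //=.
- have := proper_residual touches_sym g_anti pc pd.
  by rewrite -[in U in _ :|: U](setIidPr sUE) setUC setID => pE; eexists; exact: pE.
Qed.

End EdgeChoosability.

Section Edges.

Variable G : sgraph.
Implicit Types (x y z : G) (E : {set {set G}}).

Lemma edgesP (e : {set G}) :
  reflect (exists x y, adj x y /\ e = [set x; y]) (e \in edges G).
Proof.
rewrite inE; apply: (iffP existsP) => [[x /existsP[y /andP[xy /eqP->]]]|].
  by exists x, y.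
by case=> x [y [xy ->]]; exists x; apply/existsP; exists y; rewrite xy eqxx.
Qed.

Lemma set2_injr x : injective (fun y => [set x; y]).
Proof.
move=> y z /setP e; have := e y; have := e z; rewrite !inE !eqxx !orbT.
by move=> /orP[]/eqP-> // /esym/orP[]/eqP->.
Qed.

Lemma mem_edges x y : ([set x; y] \in edges G) = adj x y.
Proof.
apply/edgesP/idP => [[u [v [uv /setP e]]]|xy]; last by exists x, y.
have := e x; have := e y; have := e u; have := e v; rewrite !inE !eqxx !orbT /=.
move=> /orP[]/eqP ? /orP[]/eqP ? ; subst; rewrite ?adj_irr in uv * => //.
- by rewrite adj_sym.
Qed.

Definition edges_at E x := [set e in E | x \in e].

Lemma edges_atE x : edges_at (edges G) x = [set [set x; y] | y in [set y | adj x y]].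
Proof.
apply/setP => e; rewrite inE; apply/andP/imsetP => [[/edgesP[u [v [uv ->]]]]|].
  rewrite !inE => /orP[]/eqP->; first by exists v; rewrite ?inE.
  by exists u; rewrite ?inE 1?adj_sym // setUC.
by case=> y; rewrite inE => xy ->; rewrite mem_edges xy !inE eqxx.
Qed.

Lemma card_edges_at x : #|edges_at (edges G) x| = degree x.
Proof. by rewrite edges_atE card_imset //; apply: set2_injr. Qed.

Lemma card_nbrs E x y : E \subset edges G -> [set x; y] \in E ->
  #|nbrs (@touches G) E [set x; y]| + 2 = #|edges_at E x| + #|edges_at E y|.
Proof.
move=> sE xyE; set e := [set x; y].
have ex : e \in edges_at E x by rewrite !inE xyE eqxx.
have ey : e \in edges_at E y by rewrite !inE xyE eqxx orbT.
rewrite (cardsD1 e (edges_at E x)) (cardsD1 e (edges_at E y)) ex ey.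
suff -> : nbrs (@touches G) E e = (edges_at E x :\ e) :|: (edges_at E y :\ e).
  rewrite cardsU; set X := _ :&: _; suff -> : X = set0.
    by rewrite cards0 subn0 !add1n addSn !addnS addn0.
  apply/setP => f; rewrite !inE; apply/negP => /and3P[/and3P[fe fE xf] _ /andP[_ yf]].
  case/negP: fe; have /edgesP[u [v [uv fuv]]] := subsetP sE f fE.
  have xy : adj x y by rewrite -mem_edges (subsetP sE).
  move: xf yf; rewrite fuv !inE => /orP[]/eqP ex' /orP[]/eqP ey'; move: xy.
  - by rewrite ex' ey' adj_irr.
  - by rewrite /e ex' ey'.
  - by rewrite /e ex' ey' setUC.
  - by rewrite ex' ey' adj_irr.
apply/setP => f; rewrite !inE /touches eq_sym.
case: eqP => _ //=; case: (f \in E) => //=.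
apply/idP/orP => [/pred0Pn[z /andP[]]|].
  by rewrite !inE => /orP[]/eqP-> zf; [left|right].
by case=> h; apply/pred0Pn; [exists x|exists y]; rewrite /= !inE eqxx ?orbT.
Qed.

End Edges.

Section Deletion.

Variable G : sgraph.
Implicit Types (x y z : G) (U : {set {set G}}).

Definition del_adj U x y := adj x y && ([set x; y] \notin U).

Lemma del_sym U : symmetric (del_adj U).
Proof. by move=> x y; rewrite /del_adj adj_sym setUC. Qed.

Lemma del_irr U : irreflexive (del_adj U).
Proof. by move=> x; rewrite /del_adj adj_irr. Qed.

Definition del U : sgraph := SGraph (del_sym U) (del_irr U).

Lemma edges_del U : edges (del U) = edges G :\: U.
Proof.
apply/setP => e; rewrite [RHS]inE andbC.
apply/(@edgesP (del U))/andP => [[x [y [/andP[xy xyU] ->]]]|].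
  by rewrite mem_edges.
by case=> /(@edgesP G)[x [y [xy ->]]] xyU; exists x, y; split=> //; apply/andP.
Qed.

Lemma degree_del U x : degree (G := del U) x <= degree x.
Proof.
by apply: subset_leq_card; apply/subsetP => y; rewrite !inE => /andP[].
Qed.

Lemma has_net_del U k : has_net (del U) k -> has_net G k.
Proof.
case=> p [p3 pk /andP[cp up] [x [y [xp yp /andP[xy _] nx ny]]]].
exists p; split=> //; last by exists x, y.
rewrite /ucycle up andbT; case: p cp {p3 pk up xp yp nx ny} => //= z p.
by apply: sub_path => u v /andP[].
Qed.

End Deletion.
(** * Alternating cycles and vertices of degree 3 *)

(** Extend a path at its first vertex for as long as possible. When this stops,
all neighbours of the first vertex lie on the path, and one of them is not the
next vertex, so it closes a cycle. *)
Lemma ucycle_of_min_degree2 (T : finType) (e : rel T) (W : {set T}) :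
    symmetric e -> irreflexive e -> W != set0 ->
    (forall x, x \in W -> 1 < #|[set y in W | e x y]|) ->
  exists2 p, ucycle e p & 2 < size p.
Proof.
move=> e_sym e_irr /set0Pn[x0 x0W] deg2.
suff grow n x p : #|T| - size (x :: p) < n -> {subset x :: p <= W} ->
    path e x p -> uniq (x :: p) -> exists2 q, ucycle e q & 2 < size q.
  by apply: (grow _ x0 [::] (leqnn _)) => // y; rewrite inE => /eqP->.
elim: n => // n IHn in x p *; rewrite ltnS => len sW px up.
have [y /andP[yN yp]|closed] := pickP [predD [set y in W | e x y] & mem (x :: p)].
  move: yN yp; rewrite !inE => yxp /andP[yW exy].
  apply: (IHn y (x :: p)).
  - apply: leq_trans len; have : size [:: y, x & p] <= #|T|.
      rewrite -(card_uniqP _) ?max_card //= inE yxp.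
      by move: up => /= /andP[-> ->].
    by rewrite /= => h; rewrite ltn_sub2l.
  - by move=> z; rewrite inE => /predU1P[->//|]; apply: sW.
  - by rewrite /= e_sym exy px.
  - by rewrite /= inE yxp; move: up => /= /andP[-> ->].
have [y yN yh] : exists2 y, y \in [set y in W | e x y] & y != head x p.
  have : 0 < #|[set y in W | e x y] :\ head x p|.
    have := deg2 x (sW x (mem_head _ _)); rewrite (cardsD1 (head x p)).
    by case: (_ \in _) => //= h; apply: ltnW.
  by rewrite card_gt0 => /set0Pn[y /setD1P[]]; exists y.
have := closed y; rewrite /= yN andbT => /negbFE.
move: yN; rewrite !inE => /andP[yW exy].
case/predU1P=> [yx|yp]; first by rewrite yx e_irr in exy.
case/path.splitP: yp px up yh {IHn closed sW len} => p1 p2 px up yh.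
exists (x :: rcons p1 y); last first.
  by case: p1 yh {px up} => [|z p1] /=; rewrite ?eqxx // size_rcons.
move: px up; rewrite cat_path -cat_cons cat_uniq => /andP[px _] /andP[up _].
by rewrite /ucycle up andbT /= rcons_path px last_rcons e_sym.
Qed.

Section AlternatingCycles.

Variables (G : sgraph) (D : nat).
Hypotheses (D_gt3 : 3 < D) (max_deg : forall x : G, degree x <= D).
Hypothesis edge_deg : forall x y : G, adj x y -> D + 3 <= degree x + degree y.
Hypothesis choosable_del : forall U : {set {set G}}, U \subset edges G -> U != set0 ->
  edge_choosable D.+1 (edges G :\: U).

Lemma nbr_degree3 (x y : G) : adj x y -> degree x = 3 -> degree y = D.
Proof. by move=> xy dx; have := edge_deg xy; have := max_deg y; lia. Qed.

Lemma degree3_neqD (x y : G) : degree x = 3 -> degree y = D -> x != y.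
Proof. by move=> dx dy; apply/eqP => xy; move: dx dy; rewrite xy; lia. Qed.

(** The vertices of the cycle are [v 0, ..., v n.+2], and [v n.+3 = v 0]. *)
Section ClosedWalk.

Variables (v : nat -> G) (n : nat).
Hypothesis v_adj : forall i, i <= n.+2 -> adj (v i) (v i.+1).
Hypothesis v_alt : forall i, i <= n.+2 -> (degree (v i) == 3) || (degree (v i.+1) == 3).
Hypotheses (v_closed : v n.+3 = v 0) (deg_v0 : degree (v 0) = 3).
Hypothesis v_inj : forall i j, i <= n.+2 -> j <= n.+2 -> v i = v j -> i = j.

(** [U] consists of the edges at the vertices of degree 3 of the cycle, the last
edge to be coloured is [sa], and the two edges coloured first are [ta] and [sw],
where [sw] is the edge at [s] outside the cycle. Without [ta] the cycle is a path
from [t] to [a]; its edges are coloured from [t] on, and the two other edges at a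
vertex [v i] of degree 3 are coloured just before its edge to [v i.+1]. *)
Lemma reducible_alternating_cycle : edge_choosable D.+1 (edges G).
Proof.
set s := v n.+1; set a := v n.+2; set t := v 0.
have vne i j : i <= n.+2 -> j <= n.+2 -> i <> j -> v i != v j.
  by move=> li lj nij; apply/eqP => /(v_inj li lj).
have ta : adj t a.
  by have := v_adj (leqnn n.+2); rewrite v_closed adj_sym.
have da : degree a = D by apply: nbr_degree3 ta deg_v0.
have ds : degree s = 3.
  have /orP[/eqP//|] := v_alt (leqnSn n.+1).
  by rewrite -/a da => /eqP D3; move: D_gt3; rewrite D3.
pose c3 x := (degree x == 3) && [exists i : 'I_n.+3, v i == x].
have c3P i : i <= n.+2 -> degree (v i) = 3 -> c3 (v i).
  move=> li di; rewrite /c3 di eqxx; apply/existsP.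
  by exists (Ordinal (li : i < n.+3)).
pose U := [set e in edges G | [exists x in e, c3 x]].
have sU : U \subset edges G by apply/subsetP => e; rewrite inE => /andP[].
have inU x y : c3 x -> adj x y -> [set x; y] \in U.
  move=> cx xy; rewrite inE mem_edges xy; apply/existsP; exists x.
  by rewrite !inE eqxx.
have UP f : f \in U -> exists i y, [/\ i <= n.+2, degree (v i) = 3,
    adj (v i) y & f = [set v i; y]].
  rewrite inE => /andP[/edgesP[x [y [xy ->]]] /existsP[z /andP[]]].
  rewrite !inE => zxy /andP[/eqP dz /existsP[i /eqP vi]].
  case/orP: zxy => /eqP ez; [exists i, y | exists i, x];
    rewrite vi dz ez; split=> //; try (by rewrite -ltnS); last by rewrite setUC.
  by rewrite adj_sym.
have Uat x : c3 x -> edges_at U x = edges_at (edges G) x.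
  move=> cx; apply/setP => e; rewrite !inE -/(e \in edges G).
  case xe : (x \in e); rewrite ?andbF // !andbT; apply/andP/idP => [[]//|eE].
  by split=> //; apply/existsP; exists x; rewrite xe.
have [w [sw wa wn]] : exists w, [/\ adj s w, w != a & w != v n].
  have : 0 < #|[set y | adj s y] :\ a :\ v n|.
    have : #|[set y | adj s y]| = 3 by [].
    rewrite (cardsD1 a) (cardsD1 (v n) (_ :\ a)); lia.
  by rewrite card_gt0 => /set0Pn[w]; rewrite !inE => /and3P[]; exists w.
have cs : c3 s by apply: c3P.
have ct : c3 t by apply: c3P.
have sa : adj s a by apply: v_adj.
have st : s != t by apply: vne.
have dw : degree w = D by apply: nbr_degree3 sw ds.
pose rk (e : {set G}) := \sum_(i < n.+3 | (degree (v i) == 3) && (v i \in e))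
  ((n.+3 - i).*2 + (e != [set v i; v i.+1])).
have rkE i y : i <= n.+2 -> degree (v i) = 3 -> adj (v i) y ->
    rk [set v i; y] = (n.+3 - i).*2 + (y != v i.+1).
  move=> li di iy; rewrite /rk (big_pred1 (Ordinal (li : i < n.+3))) /=.
    by rewrite (inj_eq (@set2_injr G (v i))).
  move=> j; rewrite /= !inE -val_eqE /=; apply/idP/eqP => [|->].
    case/andP=> /eqP dj /orP[/eqP /v_inj|/eqP jy]; first by apply; rewrite // -ltnS.
    by have := degree3_neqD dj (nbr_degree3 iy di); rewrite jy eqxx.
  by rewrite di !eqxx.
apply: (@reducible_set _ _ _ U [set s; a] [set s; w] [set t; a] rk) => //.
- move=> f /UP[i [y [li di iy ->]]]; rewrite -(leq_add2r 2) card_nbrs ?mem_edges //.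
  by rewrite !card_edges_at di (nbr_degree3 iy di); lia.
- exact: inU.
- rewrite inE inU //= /touches (inj_eq (@set2_injr G s)) eq_sym wa /=.
  by apply/pred0Pn; exists s; rewrite /= !inE eqxx.
- rewrite inE inU //= /touches ![[set _; a]]setUC (inj_eq (@set2_injr G a)) st /=.
  by apply/pred0Pn; exists a; rewrite /= !inE eqxx.
- apply/eqP => /setP/(_ s); rewrite !inE eqxx /= (negPf st) /=.
  by move/esym; apply/negP; apply: vne.
- rewrite /touches negb_and !negbK; apply/orP; right.
  rewrite -setI_eq0; apply/eqP; apply/setP => z; rewrite !inE; apply/negP.
  case/andP=> /orP[]/eqP-> /orP[].
  + by rewrite (negPf st).
  + by apply/negP; apply: vne.
  + by apply/negP; rewrite eq_sym; apply: degree3_neqD.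
  + by rewrite (negPf wa).
(* The edges sa and ta have equally many neighbours in U, because s and t have
   degree 3 and all their edges belong to U. *)
- have -> : #|nbrs (@touches G) U [set s; a]| = #|nbrs (@touches G) U [set t; a]|.
    apply/eqP; rewrite -(eqn_add2r 2) !card_nbrs ?inU //.
    by rewrite (Uat s cs) (Uat t ct) !card_edges_at ds deg_v0.
  rewrite -{1}[#|nbrs _ _ [set t; a]|]add0n ltn_add2r card_gt0.
  apply/set0Pn; exists [set s; a]; rewrite inE inU //= /touches.
  rewrite (inj_eq (@set2_injr G s)) wa /=.
  by apply/pred0Pn; exists s; rewrite /= !inE eqxx.
- move=> f /setD1P[fe /setDP[/UP[i [y [li di iy fE]]]]].
  rewrite fE in fe * => {f fE}; rewrite !inE negb_or => /andP[fe1 fe2].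
  have ii1 := v_adj li; have ci := c3P _ li di.
  (* A neighbour still uncoloured: for the edge from v i to v i.+1 it is the edge
     from v i.+1 to v i.+2, for the other edges at v i the one to v i.+1. *)
  have [yi1|yi1] := eqVneq y (v i.+1).
    have ni : i <> n.+1 by move=> ei; case/eqP: fe; rewrite yi1 ei.
    have ni' : i <> n.+2.
      by move=> ei; have := degree3_neqD di da; rewrite ei eqxx.
    have li2 : i.+2 <= n.+2 by clear -li ni ni'; lia.
    have di1 : degree (v i.+1) = D by apply: nbr_degree3 di.
    have i12 : adj (v i.+1) (v i.+2) by apply: v_adj; apply: ltnW.
    have di2 : degree (v i.+2) = 3.
      have /orP[] := v_alt (ltnW li2); move/eqP => // d3.
      by rewrite d3 in di1; move: D_gt3; rewrite -di1.
    rewrite adj_sym in i12.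
    exists [set v i.+2; v i.+1].
      rewrite in_setD in_set2 negb_or inU ?c3P // andbT; apply/andP; split.
        apply/eqP => /setP E; have := E (v i.+2); have := E (v i.+1).
        rewrite !inE !eqxx orbT /=.
        have -> : (v i.+2 == w) = false by apply/negbTE/degree3_neqD.
        have -> : (v i.+1 == s) = false.
          by apply/negbTE; rewrite eq_sym; apply: degree3_neqD.
        rewrite orbF /= => /esym/eqP ew /esym/eqP/v_inj en.
        by case: (en li2 (leqnSn _)) => en'; case/eqP: wn; rewrite -ew en'.
      apply/eqP => /setP E; have := E (v i.+2); rewrite !inE !eqxx /=.
      have -> : (v i.+2 == a) = false by apply/negbTE/degree3_neqD.
      by rewrite orbF => /esym/eqP/v_inj-/(_ li2 isT).
    rewrite !rkE // yi1 eqxx; apply/andP; split.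
      rewrite /touches ![[set _; v i.+1]]setUC (inj_eq (@set2_injr G (v i.+1))).
      rewrite vne //=; last by clear; lia.
      by apply/pred0Pn; exists (v i.+1); rewrite /= !inE eqxx.
    by clear -li2; case: (_ != _); lia.
  exists [set v i; v i.+1].
    rewrite in_setD in_set2 negb_or inU // andbT; apply/andP; split.
      apply/eqP => /setP E; have := E (v i); have := E (v i.+1).
      rewrite !inE !eqxx orbT /=.
      have -> : (v i == w) = false by apply/negbTE/degree3_neqD.
      rewrite orbF => h /esym/eqP/v_inj ei; have {}ei := ei li (leqnSn _).
      move: h; rewrite ei -/s -/a eq_sym (negPf (vne n.+1 n.+2 _ _ _)) //=.
      by rewrite eq_sym (negPf wa).
    apply/eqP => /setP E; have := E (v i); have := E (v i.+1).
    rewrite !inE !eqxx orbT /=.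
    have -> : (v i == a) = false by apply/negbTE/degree3_neqD.
    rewrite orbF => h /esym/eqP/v_inj ei; have {}ei := ei li isT.
    by move: h; rewrite ei => /esym/orP[]/eqP/v_inj-/(_ isT) h;
      [have := h isT | have := h (leqnn _)].
  rewrite !rkE // eqxx yi1 /touches (inj_eq (@set2_injr G (v i))) yi1 addn0 addn1.
  rewrite ltnSn andbT; apply/pred0Pn; exists (v i); by rewrite /= !inE eqxx.
- apply: choosable_del => //; apply/set0Pn; exists [set s; a]; exact: inU.
Qed.

End ClosedWalk.

Definition alt (x y : G) := adj x y && ((degree x == 3) || (degree y == 3)).

Lemma alt_sym : symmetric alt.
Proof. by move=> x y; rewrite /alt adj_sym orbC. Qed.

Lemma alt_irr : irreflexive alt.
Proof. by move=> x; rewrite /alt adj_irr. Qed.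

Lemma choosable_of_alt_cycle (p : seq G) :
  ucycle alt p -> 2 < size p -> edge_choosable D.+1 (edges G).
Proof.
move=> /andP[cp up] p2.
have [t tp dt] : exists2 t, t \in p & degree t = 3.
  case: p cp p2 {up} => [//|x [//|y p]] /= /andP[/andP[_]] /orP[]/eqP d _ _.
    by exists x; rewrite ?mem_head.
  by exists y; rewrite // !inE eqxx orbT.
have [i q pq] := rot_to tp.
have sq : (size q).+1 = size p by rewrite -(size_rot i p) pq.
rewrite -(rot_cycle i) pq /= in cp; rewrite -(rot_uniq i) pq in up.
case Dq : (size q) sq => [|[|n]] sq; rewrite -?sq // in p2.
have nth_v j : j <= n.+2 -> alt (nth t (t :: q) j) (nth t (t :: q) j.+1).
  have nthE k : nth t (t :: rcons q t) k = nth t (t :: q) k.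
    rewrite -rcons_cons nth_rcons; case: ltngtP => // h.
      by rewrite nth_default // ltnW.
    by rewrite h nth_default.
  move=> lj; have := (pathP t cp) j; rewrite size_rcons Dq => /(_ lj).
  by rewrite nthE -[nth t (rcons q t) j]/(nth t (t :: rcons q t) j.+1) nthE.
apply: (@reducible_alternating_cycle (nth t (t :: q)) n) => //.
- by move=> j /nth_v/andP[].
- by move=> j /nth_v/andP[].
- by rewrite nth_default //= Dq.
- by move=> j k lj lk /eqP; rewrite nth_uniq //= ?Dq // => /eqP.
Qed.

(** Peel off the vertices of degree 3 one at a time: a vertex with a neighbour
that no other remaining vertex of degree 3 sees gets that neighbour as its private
partner. If the peeling gets stuck, the alternating edges among the remaining
vertices and their neighbours form a graph of minimum degree at least 2, hence
contain a cycle. *)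
Lemma card_degree3_le : ~ edge_choosable D.+1 (edges G) ->
  #|[set x : G | degree x == 3]| <= #|[set x : G | degree x == D]|.
Proof.
move=> notC; pose N (S : {set G}) := [set y | [exists x in S, adj x y]].
have NP (S : {set G}) y : reflect (exists2 x, x \in S & adj x y) (y \in N S).
  by rewrite inE; apply: (iffP existsP) => [[x /andP[]]|[x]]; exists x => //; apply/andP.
suff peel n (S : {set G}) : #|S| < n -> (forall x, x \in S -> degree x = 3) ->
    #|S| <= #|N S|.
  have d3 x : x \in [set x : G | degree x == 3] -> degree x = 3.
    by rewrite inE => /eqP.
  apply: leq_trans (peel _ _ (leqnn _) d3) _; apply: subset_leq_card.
  apply/subsetP => y /NP[x xS xy]; rewrite inE; apply/eqP.
  by apply: nbr_degree3 xy (d3 _ xS).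
elim: n => // n IHn in S *; rewrite ltnS => leS d3.
have [->|S0] := eqVneq S set0; first by rewrite cards0.
have [s /andP[sS /existsP[a /andP[sa aN]]]|stuck] := pickP [pred s | (s \in S) &&
    [exists a, adj s a && (a \notin N (S :\ s))]].
  rewrite (cardsD1 s) sS.
  apply: (@leq_trans (1 + #|N (S :\ s)|)).
    rewrite leq_add2l; apply: IHn => [|x /setD1P[_ /d3]//].
    by apply: leq_trans leS; rewrite [X in _ < X](cardsD1 s) sS.
  rewrite -[1 in X in X <= _]/(true : nat) -aN -cardsU1; apply: subset_leq_card.
  rewrite subUset sub1set; apply/andP; split; first by apply/NP; exists s.
  by apply/subsetP => y /NP[x /setD1P[_ xS] xy]; apply/NP; exists x.
case: notC.
have shared s a : s \in S -> adj s a -> exists2 x, x \in S :\ s & adj x a.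
  move=> sS sa; apply/NP; have := stuck s; rewrite /= sS /= => /negbT.
  by rewrite negb_exists => /forallP/(_ a); rewrite sa negbK.
have W0 : S :|: N S != set0.
  by apply: contraNneq S0 => W0; rewrite -subset0 -W0 subsetUl.
have [x|p cp p2] := ucycle_of_min_degree2 alt_sym alt_irr W0.
  case/setUP => [xS|/NP[s sS sx]].
    suff -> : [set y in S :|: N S | alt x y] = [set y | adj x y].
      by rewrite -/(degree x) d3.
    apply/setP => y; rewrite !inE /alt d3 //= andbT; case xy: (adj x y); rewrite ?andbF //.
    by rewrite andbT; apply/orP; right; apply/existsP; exists x; rewrite xS.
  have [s' /setD1P[s's s'S] s'x] := shared _ _ sS sx.
  have altN z : z \in S -> adj z x -> z \in [set y in S :|: N S | alt x y].
    by move=> zS zx; rewrite !inE zS /alt (d3 z zS) adj_sym zx orbT.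
  by rewrite (cardsD1 s) altN // (cardsD1 s') in_setD1 s's altN.
exact: choosable_of_alt_cycle cp p2.
Qed.

End AlternatingCycles.
(** * Orbits of first-return maps and components *)

Section FirstReturn.

Variables (T T' : finType) (f : T -> T) (h : T' -> T).
Hypotheses (f_inj : injective f) (h_inj : injective h).

Lemma return_ex x : exists n, iter n.+1 f (h x) \in codom h.
Proof.
exists (order f (h x)).-1.
by rewrite prednK ?order_gt0 // (iter_order f_inj) codom_f.
Qed.

Definition return_time x := ex_minn (return_ex x).

Lemma return_timeP x : iter (return_time x).+1 f (h x) \in codom h.
Proof. by rewrite /return_time; case: ex_minnP. Qed.

Lemma return_time_min x n : n < return_time x -> iter n.+1 f (h x) \notin codom h.
Proof.
rewrite /return_time; case: ex_minnP => m _ mmin; apply: contraTN => /mmin.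
by rewrite -leqNgt.
Qed.

(** The map induced by [f] on the image of [h]: iterate until the image is met
again. It has the same orbits as [f], cut down to that image. *)
Definition first_return x := iinv (return_timeP x).

Lemma first_returnE x : h (first_return x) = iter (return_time x).+1 f (h x).
Proof. exact: f_iinv. Qed.

Lemma first_return_eq x y n :
    iter n.+1 f (h x) = h y -> (forall m, m < n -> iter m.+1 f (h x) \notin codom h) ->
  first_return x = y.
Proof.
move=> xy nmin; apply: h_inj; rewrite first_returnE -xy; congr (iter _.+1 f _).
case: (ltngtP (return_time x) n) => // [/nmin|/return_time_min].
  by rewrite return_timeP.
by rewrite xy codom_f.
Qed.

Lemma first_return_inj : injective first_return.
Proof.
suff wlog_le x y : return_time x <= return_time y ->
    first_return x = first_return y -> x = y.
  by move=> x y exy; case/orP: (leq_total (return_time x) (return_time y)) => h';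
    [apply: wlog_le|apply/esym/wlog_le].
move=> le_xy /(congr1 h); rewrite !first_returnE -(subnK le_xy) -addnS addnC iterD.
have iter_inj m : injective (iter m f) by elim: m => // m IHm u w /f_inj/IHm.
move/iter_inj => hxy; apply: h_inj; rewrite hxy.
case Dd: (_ - _) hxy => [//|k] hxy.
have := @return_time_min y k; rewrite -hxy codom_f => /(_ _)/negP[] //.
by apply: leq_trans (leq_subr (return_time x) _); rewrite Dd.
Qed.

Lemma fconnect_first_return x y :
  fconnect first_return x y = fconnect f (h x) (h y).
Proof.
apply/idP/idP => [/iter_findex <-|].
  elim: (findex _ _ _) => [|n IHn] /=; first exact: connect0.
  by apply: connect_trans IHn _; rewrite first_returnE fconnect_iter.
move=> /iter_findex; set n := findex f (h x) (h y).
have [k] := ubnP n; elim: k x n => // k IHk x [|n] lt_nk.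
  by move=> /h_inj->; apply: connect0.
move=> xy; have le_n : return_time x <= n.
  rewrite leqNgt; apply/negP => /return_time_min.
  by rewrite xy codom_f.
have /= := fconnect1 first_return x; move/connect_trans; apply.
apply: (IHk _ (n - return_time x)); first by apply: leq_ltn_trans (leq_subr _ _) _.
by rewrite first_returnE -iterD addnS subnK.
Qed.

End FirstReturn.

Lemma card_porbits (T : finType) (s : {perm T}) : #|porbits s| = fcard s predT.
Proof.
have porbit_fconnect x y : (y \in porbit s x) = fconnect s x y.
  apply/porbitP/idP => [[i ->]|/iter_findex <-].
    by rewrite permX fconnect_iter.
  by exists (findex s x y); rewrite permX.
have s_sym := fconnect_sym (@perm_inj _ s).
have -> : porbits s = [set porbit s x | x in froots s].
  apply/setP => X; apply/imsetP/imsetP => [[x _ ->]|[x _ ->]]; last by exists x.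
  exists (froot s x); first exact: (roots_root s_sym).
  by apply/eqP; rewrite eq_porbit_mem porbit_fconnect s_sym connect_root.
rewrite card_in_imset => [|x y /eqP rx /eqP ry /eqP].
  by apply: eq_card => x; rewrite !inE andbT.
by rewrite eq_porbit_mem porbit_fconnect -(root_connect s_sym) ry rx => /eqP.
Qed.

(** All components but those of [x] and [y] are the same for [e1] and [e2]. *)
Lemma n_comp_add_edge (T : finType) (e1 e2 : rel T) x y :
    symmetric e1 -> symmetric e2 -> subrel e1 e2 ->
    (forall u v, e2 u v -> e1 u v \/ [set u; v] = [set x; y]) ->
  n_comp e1 predT <= n_comp e2 predT + ~~ connect e1 x y.
Proof.
move=> sym1 sym2 e12 e21.
have csym1 : connect_sym e1 by apply: sym_connect_sym.
have csym2 : connect_sym e2 by apply: sym_connect_sym.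
have sub12 : subrel (connect e1) (connect e2).
  by apply: connect_sub => u v /e12; apply: connect1.
pose a := closure e1 (pred2 x y).
have a1 : closed e1 a by apply: closure_closed.
have xa : x \in a by apply: mem_closure; rewrite !inE eqxx.
have ya : y \in a by apply: mem_closure; rewrite !inE eqxx orbT.
have a2 : closed e2 a.
  move=> u v /e21[/a1//|/setP E].
  have := E u; have := E v; rewrite !inE !eqxx orbT /=.
  by move=> /esym/orP[]/eqP-> /esym/orP[]/eqP->; rewrite ?xa ?ya.
have aC2 : closed e2 [predC a].
  by move=> u v /a2; rewrite !inE => ->.
rewrite (n_compC a) (n_compC a e2) n_comp_closure2 //.
have -> : n_comp e2 [predC a] = n_comp e1 [preim id of [predC a]].
  apply: (@adjunction_n_comp _ _ id) => //; split=> [u _|u v uC]; first by exists u.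
  apply/idP/idP => [|/connectP[p]]; first exact: sub12.
  elim: p u uC => [|w p IHp] u uC /= => [_ ->//|/andP[uw pw] lw].
  have wC : w \in [predC a] by rewrite -(aC2 u w uw).
  apply: connect_trans (IHp w wC pw lw); apply: connect1.
  case: (e21 u w uw) => // /setP/(_ u); rewrite !inE eqxx /= => /esym/orP[]/eqP eu.
    by move: uC; rewrite eu inE xa.
  by move: uC; rewrite eu inE ya.
suff : 0 < n_comp e2 a.
  by rewrite addnAC leq_add2r; case: (n_comp e2 a) => // m _; rewrite addSn ltnS leq_addl.
rewrite /n_comp_mem; apply/card_gt0P; exists (fingraph.root e2 x); rewrite !inE.
rewrite (roots_root csym2) /=.
by rewrite -(closed_connect a2 (connect_root e2 x)) xa.
Qed.

(** * Planarity of subgraphs *)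

Section Darts.

Variable G : sgraph.
Implicit Types d : dart G.

Lemma rev_dartK : involutive (@rev_dart G).
Proof. by case=> -[x y] xy; apply: val_inj. Qed.

Lemma rev_dart_inj : injective (@rev_dart G).
Proof. exact: inv_inj rev_dartK. Qed.

Definition dart_head d : G := (val d).2.
Definition dart_edge d : {set G} := [set tail d; dart_head d].

Lemma tail_rev d : tail (rev_dart d) = dart_head d. Proof. by []. Qed.
Lemma head_rev d : dart_head (rev_dart d) = tail d. Proof. by []. Qed.

Lemma dart_edge_rev d : dart_edge (rev_dart d) = dart_edge d.
Proof. exact: setUC. Qed.

Lemma adj_dart d : adj (tail d) (dart_head d).
Proof. exact: (valP d). Qed.

Lemma dart_eq d d' : tail d = tail d' -> dart_head d = dart_head d' -> d = d'.
Proof.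
by case: d d' => -[x y] xy [[x' y'] x'y'] /= ? ?; apply: val_inj; congr pair.
Qed.

Lemma rev_dart_neq d : rev_dart d != d.
Proof.
apply: contraTneq (adj_dart d) => /(congr1 (@tail G)).
by rewrite tail_rev => ->; rewrite adj_irr.
Qed.

Lemma dart_edge_eq d d' :
  dart_edge d = dart_edge d' -> d' = d \/ d' = rev_dart d.
Proof.
move/setP => E; have := E (tail d); have := E (dart_head d); rewrite !inE !eqxx orbT /=.
have := adj_dart d.
move=> dd /esym/orP[]/eqP hd /esym/orP[]/eqP td.
- by rewrite hd td adj_irr in dd.
- by right; apply: dart_eq.
- by left; apply: dart_eq.
- by rewrite hd td adj_irr in dd.
Qed.

Lemma edge_dart e : e \in edges G -> exists d, dart_edge d = e.
Proof.
by case/edgesP=> x [y [xy ->]]; exists (exist (fun d : G * G => adj d.1 d.2) (x, y) xy).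
Qed.

Lemma degree_neq0 d : degree (tail d) != 0.
Proof.
by rewrite -lt0n card_gt0; apply/set0Pn; exists (dart_head d); rewrite inE adj_dart.
Qed.

End Darts.

Section PlanarDeletion.

Variables (G : sgraph) (s : {perm dart G}).
Hypothesis s_rot : rotation_system s.
Implicit Types (d : dart G) (U : {set {set G}}).

Lemma tail_rot d : tail (s d) = tail d.
Proof. by apply/esym/eqP; rewrite -s_rot fconnect1. Qed.

(** The darts of a deleted edge stay attached to their vertices as dangling half
edges, and a face walk that meets one of them passes on to the next dart of the
vertex. Hence all subgraphs share one set of darts, and restoring an edge
multiplies the face permutation by a transposition. *)
Definition keep_rev U d := if dart_edge d \in U then d else rev_dart d.

Lemma keep_revK U : involutive (keep_rev U).
Proof.
move=> d; rewrite /keep_rev; case dU: (dart_edge d \in U); first by rewrite dU.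
by rewrite dart_edge_rev dU rev_dartK.
Qed.

Definition face_perm U : {perm dart G} := (perm (inv_inj (keep_revK U)) * s)%g.

Lemma face_permE U d : face_perm U d = s (keep_rev U d).
Proof. by rewrite permM permE. Qed.

Lemma face_connect U d d' :
  d' \in porbit (face_perm U) d -> connect (del_adj U) (tail d) (tail d').
Proof.
case/porbitP => i ->; rewrite permX; elim: i => [|i IHi] /=; first exact: connect0.
apply: connect_trans IHi _; set z := iter _ _ _; rewrite face_permE tail_rot.
rewrite /keep_rev; case: ifP => [_|/negbT zU]; first exact: connect0.
by apply: connect1; rewrite /del_adj adj_dart.
Qed.

Lemma face_perm_restore U d : dart_edge d \in U ->
  face_perm (U :\ dart_edge d) = (tperm d (rev_dart d) * face_perm U)%g.
Proof.
move=> dU; apply/perm.permP => z; rewrite permM !face_permE; congr (s _).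
rewrite /keep_rev; have [->|nzd] := eqVneq z d.
  by rewrite tpermL dart_edge_rev dU setD11.
have [->|nzr] := eqVneq z (rev_dart d).
  by rewrite tpermR dart_edge_rev dU setD11 rev_dartK.
rewrite tpermD 1?eq_sym // in_setD1; have [E|//] := eqVneq (dart_edge z) _.
by case: (dart_edge_eq (esym E)) => zd; rewrite zd eqxx in nzd nzr.
Qed.

(** Restoring an edge splits a face when both its darts lie on the same face, and
merges two faces otherwise. In the first case the face walk connects the ends of
the edge, so the number of components does not change. *)
Lemma euler_restore U e : e \in U -> U \subset edges G ->
  #|porbits (face_perm (U :\ e))| + 2 * n_comp (del_adj U) predT <=
  #|porbits (face_perm U)| + 1 + 2 * n_comp (del_adj (U :\ e)) predT.
Proof.
move=> eU sU; have [d de] := edge_dart (subsetP sU e eU); subst e.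
have := porbits_mul_tperm (face_perm U) d (rev_dart d).
rewrite /= -face_perm_restore // eq_sym rev_dart_neq.
have := n_comp_add_edge (del_sym U) (del_sym (U :\ dart_edge d))
  (x := tail d) (y := dart_head d).
move=> /(_ _ _); set c1 := n_comp_mem _ _; set c2 := n_comp_mem _ _ => H.
have {H} : c1 <= c2 + ~~ connect (del_adj U) (tail d) (dart_head d).
  apply: H => [u v /andP[uv uvU]|u v /andP[uv]].
    by rewrite /= /del_adj uv in_setD1 negb_and uvU orbT.
  rewrite in_setD1 negb_and negbK => /orP[/eqP->|uvU]; first by right.
  by left; rewrite /del_adj uv.
case: (boolP (d \in _)) => [|_]; last first.
  by case: connect => /=; set p1 := #|_|; set p2 := #|_|; clearbody c1 c2 p1 p2; clear; lia.
rewrite porbit_sym => /face_connect -> /=.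
by set p1 := #|_|; set p2 := #|_|; clearbody c1 c2 p1 p2; clear; lia.
Qed.

(** [V - E + F - 2c] does not increase from the subgraph without [U'] to the larger
subgraph without [U]. *)
Lemma euler_mono U U' : U \subset U' -> U' \subset edges G ->
  #|porbits (face_perm U)| + 2 * n_comp (del_adj U') predT <=
  #|porbits (face_perm U')| + #|U' :\: U| + 2 * n_comp (del_adj U) predT.
Proof.
have [n] := ubnP #|U' :\: U|; elim: n => // n IHn in U' *; rewrite ltnS => len sUU' sU'.
have [U'U|/set0Pn[e eU]] := eqVneq (U' :\: U) set0.
  suff -> : U' = U by rewrite leq_add2r leq_addr.
  by apply/eqP; rewrite eqEsubset sUU' andbT -setD_eq0 U'U.
have [eU' eU0] := setDP eU.
have cardE : #|U' :\: U| = #|(U' :\ e) :\: U|.+1.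
  by rewrite (cardsD1 e) eU setDDl setUC -setDDl.
have := IHn (U' :\ e); rewrite -cardE => /(_ len).
rewrite subsetD1 sUU' eU0 => /(_ isT (subset_trans (subsetDl _ _) sU')).
have := euler_restore eU' sU'; rewrite cardE; lia.
Qed.

Lemma card_vertex_orbits (p : dart G -> dart G) (a : {set G}) :
    injective p -> (forall x, x \in a -> degree x != 0) ->
    (forall d d', tail d \in a -> fconnect p d d' = (tail d == tail d')) ->
  fcard p [preim (@tail G) of a] = #|a|.
Proof.
move=> p_inj a0 aP; have p_sym := fconnect_sym p_inj.
have id_sym := fconnect_sym (@inj_id G).
have cl : closed (frel id) a by move=> x y /eqP<-.
rewrite -[RHS]fcard_id; apply/esym/adjunction_n_comp => //.
have idE (x y : G) : fconnect id x y = (x == y).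
  apply/idP/eqP => [/iter_findex <-|->]; last exact: connect0.
  by elim: findex => //= n <-.
split=> [x xa|d d' da]; last by rewrite aP ?idE.
have [y xy|none] := pickP [pred y | adj x y].
  exists (exist (fun d : G * G => adj d.1 d.2) (x, y) xy); exact: connect0.
case/negP: (a0 x xa); rewrite cards_eq0; apply/eqP/setP => y.
by rewrite !inE; apply: none.
Qed.

Variable U : {set {set G}}.

Definition keep_dart (d : dart (del U)) : dart G :=
  exist (fun d : G * G => adj d.1 d.2) (val d) (proj1 (andP (valP d))).

Lemma keep_dart_inj : injective keep_dart.
Proof. by move=> d d' /(congr1 val) e; apply: val_inj. Qed.

Lemma codom_keep_dart d : (d \in codom keep_dart) = (dart_edge d \notin U).
Proof.
apply/codomP/idP => [[d' ->]|dU]; first by case/andP: (valP d').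
have dd : del_adj U (val d).1 (val d).2 by rewrite /del_adj adj_dart.
by exists (exist (fun d : G * G => del_adj U d.1 d.2) (val d) dd); apply: val_inj.
Qed.

Let G' := del U.
Let s' : {perm dart G'} :=
  perm (first_return_inj (f_inj := @perm_inj _ s) keep_dart_inj).

Lemma rotation_system_del : rotation_system s'.
Proof.
move=> d d'; have -> : fconnect s' d d' =
    fconnect (first_return keep_dart (@perm_inj _ s)) d d'.
  by apply: eq_connect => x y; rewrite /= permE.
by rewrite (fconnect_first_return _ keep_dart_inj) s_rot.
Qed.

(* Both sides turn around the head of d until they find a remaining dart. *)
Lemma face_first_return (d : dart G') :
  first_return keep_dart (@perm_inj _ (face_perm U)) d = s' (rev_dart d).
Proof.
set r := rev_dart d; rewrite permE.
have rE : keep_dart r = rev_dart (keep_dart d) by apply: val_inj.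
pose n := return_time keep_dart (@perm_inj _ s) r.
have iterE m : m <= n -> iter m.+1 (face_perm U) (keep_dart d) = iter m.+1 s (keep_dart r).
  elim: m => [_|m IHm lt_mn].
    rewrite /= face_permE /keep_rev rE ifN // -codom_keep_dart codom_f //.
  rewrite iterS IHm ?(ltnW lt_mn) // face_permE /keep_rev ifT //.
  by have := return_time_min lt_mn; rewrite codom_keep_dart negbK.
apply: (first_return_eq _ keep_dart_inj (n := n)).
  by rewrite iterE // first_returnE.
by move=> m lt_mn; rewrite iterE ?(ltnW lt_mn) //; apply: return_time_min lt_mn.
Qed.

(* Around a vertex that becomes isolated all darts are dangling: the face
   permutation turns around it, which gives the one face of an isolated vertex. *)
Let dead : {set G} := [set x : G | (degree (G := G) x != 0) && (degree (G := G') x == 0)].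

Lemma dead_dart d : tail d \in dead -> dart_edge d \in U.
Proof.
rewrite inE => /andP[_]; rewrite cards_eq0 => /eqP/setP/(_ (dart_head d)).
by rewrite !inE /= /del_adj adj_dart /= => /negbFE.
Qed.

Lemma fcard_dead : fcard (face_perm U) [preim (@tail G) of dead] = #|dead|.
Proof.
apply: card_vertex_orbits => [||d d' dd]; first exact: perm_inj.
  by move=> x; rewrite inE => /andP[].
have iterE n : iter n (face_perm U) d = iter n s d.
  elim: n => //= n ->; rewrite face_permE /keep_rev ifT //; apply: dead_dart.
  suff -> : tail (iter n s d) = tail d by [].
  by elim: n => //= n <-; rewrite tail_rot.
rewrite -s_rot; apply/idP/idP => /iter_findex <-; first by rewrite iterE fconnect_iter.
by rewrite -iterE fconnect_iter.
Qed.

Lemma num_faces_del :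
  num_faces s' = #|porbits (face_perm U)| + #|[set x : G | degree x == 0]|.
Proof.
rewrite card_porbits (n_compC [preim (@tail G) of dead]) fcard_dead.
have f_sym := fconnect_sym (@perm_inj _ (face_perm U)).
have f'_inj := first_return_inj (f_inj := @perm_inj _ (face_perm U)) keep_dart_inj.
rewrite (@adjunction_n_comp _ _ keep_dart _ _ f_sym (fconnect_sym f'_inj)); first last.
- split=> [d|d d' _]; last exact: fconnect_first_return keep_dart_inj _ _.
  rewrite !inE degree_neq0 /= => dd.
  suff ex n : dart_edge (iter n s d) \notin U ->
      {d' : dart G' | fconnect (face_perm U) d (keep_dart d')}.
    have [d' d'P|none] := pickP [pred d' | (tail d' == tail d) && (dart_edge d' \notin U)].
      apply: (ex (findex s d d')); rewrite iter_findex; first by case/andP: d'P.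
      by rewrite s_rot eq_sym; case/andP: d'P.
    case/negP: dd; rewrite cards_eq0; apply/eqP/setP => y; rewrite !inE.
    apply/negP => /andP[xy xyU].
    have := none (exist (fun d : G * G => adj d.1 d.2) (tail d, y) xy).
    by rewrite /= eqxx xyU.
  move=> nU; have exn : exists n, dart_edge (iter n s d) \notin U by exists n.
  have [m mU mmin] := ex_minnP exn; rewrite -codom_keep_dart in mU.
  exists (iinv mU); rewrite f_iinv.
  suff -> : iter m s d = iter m (face_perm U) d by apply: fconnect_iter.
  have {mU} : forall k, k < m -> dart_edge (iter k s d) \in U.
    by move=> k; apply: contraTT => /mmin; rewrite -leqNgt.
  elim: m {mmin} => //= m IHm kU; rewrite -IHm => [|k /ltnW/kU//].
  by rewrite face_permE /keep_rev kU.
- move=> d _ /eqP<-; rewrite !inE !degree_neq0 face_permE tail_rot /keep_rev /=.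
  case: ifP => // /negbT dU; congr negb.
  have hd (x y : G) : adj x y -> [set x; y] \notin U -> (degree (G := G') x == 0) = false.
    move=> xy xyU; apply/negbTE; rewrite -lt0n card_gt0; apply/set0Pn; exists y.
    by rewrite inE /= /del_adj xy.
  rewrite -dart_edge_rev in dU; have hr := hd _ _ (adj_dart (rev_dart d)) dU.
  rewrite dart_edge_rev in dU; exact: etrans (hd _ _ (adj_dart d) dU) (esym hr).
rewrite /num_faces addnAC [RHS]addnC; congr (_ + _).
  rewrite (eq_fcard (f' := first_return keep_dart (@perm_inj _ (face_perm U)))).
    apply: eq_n_comp_r => d; rewrite !inE degree_neq0 /=.
    by rewrite (degree_neq0 (G := G') d).
  by move=> d; rewrite /= face_first_return.
rewrite -cardsUI; set X := _ :&: _; suff -> : X = set0.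
  rewrite cards0 addn0; apply: (@eq_card G) => x; rewrite !inE.
  have := degree_del U x; case: (degree (G := G) x =P 0) => [->|_ _].
    by rewrite leqn0 => ->.
  by rewrite orbF.
by apply/setP => x; rewrite !inE; case: (degree (G := G) x == 0); rewrite /= ?andbF.
Qed.

End PlanarDeletion.

(** By [euler_mono], the value of [V - E + F - 2c] for a subgraph lies between that
for [G], which is 0 by planarity, and that for the graph without edges, which is 0
because each vertex is then a component with one face. *)
Theorem planar_del (G : sgraph) (U : {set {set G}}) :
  planar G -> U \subset edges G -> planar (del U).
Proof.
case=> s s_rot; rewrite /num_faces => euler sU.
exists (perm (first_return_inj (f_inj := @perm_inj _ s) (@keep_dart_inj G U))).
  exact: rotation_system_del.
rewrite num_faces_del // edges_del.
have := euler_mono s_rot (sub0set U) sU; have := euler_mono s_rot sU (subxx _).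
have idE (x y : G) : fconnect id x y = (x == y).
  apply/idP/eqP => [/iter_findex <-|->]; last exact: connect0.
  by elim: findex => //= n <-.
have -> : n_comp (del_adj (edges G)) predT = #|G|.
  rewrite -(fcard_id (predT : {pred G})); apply: eq_n_comp => x y.
  rewrite idE; apply/connectP/eqP => [[[|z p] /= + ->//]|->]; last by exists nil.
  by rewrite /del_adj mem_edges andbN.
have -> : n_comp (@del_adj G set0) predT = n_comp (@adj G) predT.
  apply: (@eq_n_comp G); apply: eq_connect => x y.
  by rewrite /del_adj inE andbT.
have F0 : #|porbits (face_perm s set0)| = fcard (s \o @rev_dart G) predT.
  rewrite card_porbits; apply: eq_fcard => d.
  by rewrite face_permE /keep_rev inE.
have FE : #|porbits (face_perm s (edges G))| = #|[set x : G | degree x != 0]|.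
  rewrite card_porbits -(@card_vertex_orbits G (face_perm s (edges G))).
  - apply: eq_n_comp_r => d; rewrite !inE degree_neq0 //.
  - exact: perm_inj.
  - by move=> x; rewrite inE.
  - move=> d d' _; rewrite -s_rot; apply: eq_connect => x y /=.
    by rewrite face_permE /keep_rev mem_edges adj_dart.
have VE : #|G| = #|[set x : G | degree x == 0]| + #|[set x : G | degree x != 0]|.
  rewrite -(cardC [set x : G | degree x == 0]); congr (_ + _).
  by apply: eq_card => x; rewrite !inE.
have EE : #|edges G :\: U| = #|edges G| - #|U| by rewrite cardsD (setIidPr sU).
have UE := subset_leq_card sU.
rewrite FE F0 setD0 EE -[#|del U|]/(#|G|) -[n_comp (@adj (del U)) _]/(n_comp (del_adj U) predT).
move: euler VE UE; clear; set c := n_comp _ _; set c' := n_comp _ _.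
set f := n_comp _ _; lia.
Qed.
(** * Faces, corners and triangles of an embedding *)

(** A chord cuts the cycle into two non-trivial arcs [q1] and [q2]. *)
Lemma net_of_chord (G : sgraph) (x y : G) q1 q2 :
    ucycle (@adj G) (x :: q1 ++ y :: q2) -> 0 < size q1 -> 0 < size q2 ->
    adj x y ->
  has_net G (size q1 + size q2).+2.
Proof.
move=> cp s1 s2 xy; have /andP[_ up] := cp.
exists (x :: q1 ++ y :: q2); split=> //;
  rewrite ?[size (_ :: _)]/= ?size_cat ?[size (y :: _)]/= ?addnS //.
  by rewrite !ltnS; case: (size q1) s1.
exists x, y; split=> //; rewrite ?mem_head //.
- by rewrite inE mem_cat mem_head !orbT.
- case: q1 s1 up {cp} => //= a q1 _ /and3P[_]; rewrite eqxx.
  by rewrite mem_cat inE !negb_or => /and3P[_ ya _] _; rewrite eq_sym in ya *.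
have -> : next (x :: q1 ++ y :: q2) y = next (rot (size (x :: q1)) (x :: q1 ++ y :: q2)) y.
  by rewrite next_rot.
rewrite -cat_cons rot_size_cat; case: q2 s2 up {cp} => //= b q2 _ /andP[xN _].
rewrite eqxx; apply: contraNneq xN => ->.
by rewrite mem_cat !inE eqxx !orbT.
Qed.

Lemma card_darts_at (G : sgraph) (v : G) : #|[set d : dart G | tail d == v]| = degree v.
Proof.
rewrite /degree; have -> : [set y | adj v y] = (@dart_head G) @: [set d | tail d == v].
  apply/setP => y; rewrite inE; apply/idP/imsetP => [vy|[d]].
    by exists (exist (fun d : G * G => adj d.1 d.2) (v, y) vy); rewrite // inE.
  by rewrite inE => /eqP<- ->; apply: adj_dart.
rewrite card_in_imset // => d d'; rewrite !inE => /eqP td /eqP td'.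
by apply: dart_eq; rewrite td td'.
Qed.
Section Faces.

Variables (G : sgraph) (s : {perm dart G}).
Hypothesis s_rot : rotation_system s.
Hypothesis min_deg : forall d : dart G, 3 <= degree (tail d).
Implicit Types d : dart G.

Definition face_next d := s (rev_dart d).
Definition face_size d := order face_next d.
Definition tri d := face_size d == 3.

Let rot := tail_rot s_rot.

Lemma face_next_inj : injective face_next.
Proof. by move=> d d' /perm_inj/rev_dart_inj. Qed.

Lemma tail_face_next d : tail (face_next d) = dart_head d.
Proof. by rewrite /face_next rot. Qed.

Lemma face_next_rev d : face_next (rev_dart d) = s d.
Proof. by rewrite /face_next rev_dartK. Qed.

Lemma order_rot d : order s d = degree (tail d).
Proof.
rewrite -card_darts_at; apply: eq_card => d'.
by rewrite inE -topredE /= s_rot eq_sym.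
Qed.

Lemma tail_iter_rot d i : tail (iter i s d) = tail d.
Proof. by elim: i => //= i <-; rewrite rot. Qed.

Lemma iter_rot_neq d i j : i < j < degree (tail d) ->
  dart_head (iter i s d) != dart_head (iter j s d).
Proof.
case/andP=> lt_ij ltj; rewrite -order_rot in ltj.
apply/eqP => hh; have : iter i s d = iter j s d.
  by apply: dart_eq; rewrite ?tail_iter_rot.
have lti := ltn_trans lt_ij ltj.
rewrite -(nth_traject s lti) -(nth_traject s ltj) => /eqP; rewrite -/(orbit s d).
by rewrite nth_uniq ?orbit_uniq ?size_orbit // => /eqP E; rewrite E ltnn in lt_ij.
Qed.

Lemma head_rot_neq d : dart_head (s d) != dart_head d.
Proof. by rewrite eq_sym (iter_rot_neq (i := 0) (j := 1)) //= ltnW. Qed.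

Lemma head_rot2_neq d : dart_head (s (s d)) != dart_head d.
Proof. by rewrite eq_sym (iter_rot_neq (i := 0) (j := 2)) //=. Qed.

Lemma head_face_next_neq d : dart_head (face_next d) != tail d.
Proof. by rewrite /face_next -head_rev head_rot_neq. Qed.

Lemma iter_face_size d : iter (face_size d) face_next d = d.
Proof. exact: iter_order face_next_inj _. Qed.

Lemma face_size_ge3 d : 3 <= face_size d.
Proof.
rewrite leqNgt; apply/negP => lt3; have := iter_face_size d.
case: (face_size d) (order_gt0 face_next d : 0 < face_size d) lt3 => [|[|[|//]]] //= _ _.
  move/(congr1 (@tail G)); rewrite tail_face_next => E.
  by have := adj_dart d; rewrite E adj_irr.
move/(congr1 (@tail G)); rewrite tail_face_next => E.
by have := head_face_next_neq d; rewrite E eqxx.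
Qed.

Lemma face_size_connect d d' : fconnect face_next d d' -> face_size d = face_size d'.
Proof.
move=> dd'; apply: eq_card => z; rewrite -!topredE /=.
exact: (same_connect (fconnect_sym face_next_inj) dd').
Qed.

Lemma face_size_next d : face_size (face_next d) = face_size d.
Proof. by apply/esym/face_size_connect; apply: fconnect1. Qed.

Lemma tri_next d : tri (face_next d) = tri d.
Proof. by rewrite /tri face_size_next. Qed.

Lemma tri_rot d : tri (s d) = tri (rev_dart d).
Proof. by rewrite -face_next_rev tri_next. Qed.

Lemma tri_third d : tri d -> dart_head (face_next (face_next d)) = tail d.
Proof.
move/eqP => d3; have := iter_face_size d.
by rewrite d3 /= => {2}<-; rewrite tail_face_next.
Qed.

(** The face following [rev_dart d] turns from [d] to [s d] at their common tail,
so that [tri (s d)] says that the corner between these two darts is triangular. *)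
Lemma tri_corner d : tri (s d) -> adj (dart_head d) (dart_head (s d)).
Proof.
rewrite tri_rot => /tri_third; rewrite face_next_rev tail_rev => <-.
by rewrite -(tail_face_next (s d)) adj_sym adj_dart.
Qed.

Lemma adj_iter_rot d i : adj (tail d) (dart_head (iter i s d)).
Proof. by rewrite -(tail_iter_rot d i) adj_dart. Qed.

(** Four consecutive neighbours of [u] joined by three triangles form a cycle of
length 5 with [u], of which [u] sees every vertex. *)
Lemma three_tri_corners d : ~ has_net G 5 -> 4 <= degree (tail d) ->
  ~~ [&& tri (s d), tri (s (s d)) & tri (s (s (s d)))].
Proof.
move=> no5 d4; apply/negP => /and3P[/tri_corner a1 /tri_corner a2 /tri_corner a3].
case: no5; set u := tail d; set x0 := dart_head d in a1 *.
set x1 := dart_head (s d) in a1 a2 *; set x2 := dart_head (s (s d)) in a2 a3 *.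
set x3 := dart_head _ in a3.
have u0 := adj_iter_rot d 0; have u1 := adj_iter_rot d 1.
have u3 := adj_iter_rot d 3; have u2 := adj_iter_rot d 2.
have neq i j : i < j < degree (tail d) -> _ := @iter_rot_neq d i j.
have ne y : adj u y -> u != y by apply: contraTneq => <-; rewrite adj_irr.
apply: (@net_of_chord G u x1 [:: x0] [:: x2; x3]) => //.
rewrite /ucycle /= a1 a2 a3 u0 adj_sym u3 /= !inE !negb_or !ne //.
by rewrite (neq 0 1) ?(neq 0 2) ?(neq 0 3) ?(neq 1 2) ?(neq 1 3) ?(neq 2 3) //= ?d4 // ltnW.
Qed.

Lemma two_tri_corners d : ~ has_net G 4 -> ~~ (tri (s d) && tri (s (s d))).
Proof.
move=> no4; apply/negP => /andP[/tri_corner a1 /tri_corner a2].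
case: no4; set u := tail d; set x0 := dart_head d in a1 *.
set x1 := dart_head (s d) in a1 a2 *; set x2 := dart_head (s (s d)) in a2 *.
have u0 := adj_iter_rot d 0; have u1 := adj_iter_rot d 1.
have u2 := adj_iter_rot d 2.
have neq i j : i < j < degree (tail d) -> _ := @iter_rot_neq d i j.
have ne y : adj u y -> u != y by apply: contraTneq => <-; rewrite adj_irr.
apply: (@net_of_chord G u x1 [:: x0] [:: x2]) => //.
rewrite /ucycle /= a1 a2 u0 adj_sym u2 /= !inE !negb_or !ne //.
by rewrite (neq 0 1) ?(neq 0 2) ?(neq 1 2) //= ?min_deg // ltnW.
Qed.

Definition tri_at (v : G) : nat := \sum_(d | tail d == v) tri d.

Lemma sum_rot v (F : dart G -> nat) :
  \sum_(d | tail d == v) F (s d) = \sum_(d | tail d == v) F d.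
Proof.
by rewrite [RHS](reindex_inj (@perm_inj _ s)); apply: eq_bigl => d; rewrite rot.
Qed.

Lemma sum_const_at v c : \sum_(d : dart G | tail d == v) c = c * degree v.
Proof. by rewrite sum_nat_const mulnC -card_darts_at cardsE. Qed.

(** Sum over all rotations: among any three consecutive corners at most two are
triangular. *)
Lemma tri_at_no5 v : ~ has_net G 5 -> 4 <= degree v -> 3 * tri_at v <= 2 * degree v.
Proof.
move=> no5 v4; rewrite -sum_const_at.
apply: (@leq_trans (\sum_(d | tail d == v) (tri (s d) + tri (s (s d)) + tri (s (s (s d)))))).
  rewrite !big_split /= (sum_rot v (fun d => tri (s (s d)))).
  by rewrite (sum_rot v (fun d => tri (s d))) (sum_rot v tri) -/(tri_at v); lia.
apply: leq_sum => d /eqP dv; have := @three_tri_corners d no5; rewrite dv => /(_ v4).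
by do 3!case: (tri _).
Qed.

Lemma tri_at_no4 v : ~ has_net G 4 -> 2 * tri_at v <= degree v.
Proof.
move=> no4; rewrite -[degree v]mul1n -sum_const_at.
apply: (@leq_trans (\sum_(d | tail d == v) (tri (s d) + tri (s (s d))))).
  rewrite !big_split /= (sum_rot v (fun d => tri (s d))) (sum_rot v tri).
  by rewrite -/(tri_at v); lia.
apply: leq_sum => d /eqP dv; have := two_tri_corners d no4.
by do 2!case: (tri _).
Qed.

Definition num_tri : nat := \sum_d tri d.

Lemma sum_by_tail (F : dart G -> nat) :
  \sum_d F d = \sum_(v : G) \sum_(d | tail d == v) F d.
Proof. exact: (partition_big (@tail G) predT). Qed.

Lemma sum_face_next (F : dart G -> nat) : \sum_d F (face_next d) = \sum_d F d.
Proof. by rewrite [RHS](reindex_inj face_next_inj). Qed.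

(** Each dart of a triangle collects the weights of the three corners, so every
corner is counted three times. *)
Lemma tri_weight (h : G -> nat) m :
    (forall d, tri d -> m <= h (tail d) + h (tail (face_next d)) +
                             h (tail (face_next (face_next d)))) ->
  m * num_tri <= 3 * \sum_(v : G) h v * tri_at v.
Proof.
move=> hm; pose F d := h (tail d) * tri d.
have -> : \sum_(v : G) h v * tri_at v = \sum_d F d.
  rewrite sum_by_tail; apply: eq_bigr => v _; rewrite /tri_at big_distrr /=.
  by apply: eq_bigr => d /eqP<-.
rewrite /num_tri big_distrr /=.
have -> : 3 * \sum_d F d =
    \sum_d (F d + F (face_next d) + F (face_next (face_next d))).
  have e2 : \sum_d F (face_next (face_next d)) = \sum_d F (face_next d).
    exact: (sum_face_next (fun d => F (face_next d))).
  by rewrite !big_split /= e2 sum_face_next !mulSn mul0n addn0 addnA.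
apply: leq_sum => d _; rewrite /F !tri_next.
by case: (boolP (tri d)) => [/hm|]; rewrite ?muln0 // !muln1.
Qed.

Lemma face_weights (w : dart G -> nat) c :
    (forall d, c <= \sum_(d' | fconnect face_next d d') w d') ->
  c * fcard face_next predT <= \sum_d w d.
Proof.
move=> cw; have f_sym := fconnect_sym face_next_inj.
rewrite (partition_big (froot face_next) (froots face_next)) => [|d _]; last first.
  exact: roots_root.
have -> : c * fcard face_next predT = \sum_(r | froots face_next r) c.
  rewrite sum_nat_const mulnC; congr (_ * _).
  by apply: eq_card => d; rewrite !inE andbT.
apply: leq_sum => r /eqP rr; apply: leq_trans (cw r) _.
rewrite (eq_bigl (fun d => froot face_next d == r)) // => d /=.
by rewrite f_sym -(root_connect f_sym) rr.
Qed.

(** Faces are charged through the darts on their boundary: every dart counts 3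
towards its face, and a triangle, too short to reach 12 that way, needs one more
for each of its darts. *)
Lemma faces_le : 12 * fcard face_next predT <= 3 * #|dart G| + num_tri.
Proof.
have -> : 3 * #|dart G| + num_tri = \sum_(d : dart G) (3 + tri d).
  by rewrite big_split /= sum_nat_const mulnC.
apply: face_weights => d.
apply: (@leq_trans (face_size d * (3 + tri d))).
  rewrite /tri; have := face_size_ge3 d; case: eqP => [-> //|]; lia.
rewrite -sum_nat_const; rewrite (eq_bigr (fun d' => 3 + tri d')) // => d' dd'.
by rewrite /tri (face_size_connect dd').
Qed.

(** Let [abc] be the triangle and let [x] and [y] be the neighbours of [a] and [b]
on the boundary of the other face. Since degrees are at least 3, [x] and [y] differ
from [c]. A face of length 4 would give the 5-net [a c b y x]; a face of length 5
with fifth vertex [z] gives the 6-net [a c b y z x], or, if [z = c], the 5-net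
[a x c y b]. *)
Lemma face_across_tri d : ~ has_net G 5 -> ~ has_net G 6 ->
  tri d -> ~~ tri (rev_dart d) -> 6 <= face_size (rev_dart d).
Proof.
move=> no5 no6 td ntr; set e := rev_dart d in ntr *.
set a := tail d; set b := dart_head d.
set f := face_next (face_next d); set c := dart_head (face_next d).
have ca : dart_head f = a by apply: tri_third.
have sf : s (rev_dart f) = d by move/eqP: td => d3; rewrite -[RHS]iter_face_size d3.
have ab : adj a b by apply: adj_dart.
have bc : adj b c by rewrite /b -(tail_face_next d) adj_dart.
have ac : adj a c by rewrite -ca adj_sym /c -tail_face_next adj_dart.
set x := dart_head (face_next e).
have ax : adj a x by have := adj_dart (face_next e); rewrite tail_face_next.
have xb : x != b by rewrite /x face_next_rev head_rot_neq.
have xc : x != c.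
  have := head_rot2_neq (rev_dart f).
  by rewrite sf head_rev [tail f]tail_face_next /x face_next_rev.
have xa : x != a by apply: contraTneq ax => ->; rewrite adj_irr.
have ba : b != a by apply: contraTneq ab => ->; rewrite adj_irr.
have ca' : c != a by apply: contraTneq ac => ->; rewrite adj_irr.
have cb : c != b by apply: contraTneq bc => ->; rewrite adj_irr.
have prev k : face_next k = e ->
    [/\ tail k != a, tail k != c, tail k != b & adj (tail k) b].
  move=> ke; have kb : dart_head k = b by rewrite -tail_face_next ke.
  have bk : adj (tail k) b by rewrite -kb adj_dart.
  split=> //; last by apply: contraTneq bk => ->; rewrite adj_irr.
    have := head_rot_neq (rev_dart k).
    by rewrite -[s (rev_dart k)]/(face_next k) ke eq_sym.
  have := head_rot2_neq (rev_dart k).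
  by rewrite -[s (rev_dart k)]/(face_next k) ke eq_sym.
have ne2 (u v : G) : u != v -> ((u == v) = false) * ((v == u) = false).
  by move=> uv; rewrite [v == u]eq_sym (negPf uv).
have adj2 (u v : G) : adj u v -> adj u v * adj v u.
  by move=> uv; rewrite [adj v u]adj_sym uv.
have ends k : face_next k = e -> dart_head k = b.
  by move=> ke; rewrite -tail_face_next ke.
have := face_size_ge3 e; have := iter_face_size e; move: ntr; rewrite /tri.
case: (face_size e) => [|[|[|[|[|[|//]]]]]] //= _.
- set e1 := face_next e; set k := face_next (face_next e1) => /prev[ka kc kb kb'] _.
  have xk : adj x (tail k).
    by rewrite /k tail_face_next -[x]tail_face_next adj_dart.
  have kx : tail k != x by apply: contraTneq xk => ->; rewrite adj_irr.
  case: no5; apply: (@net_of_chord G a b [:: c] [:: tail k; x]) => //.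
  rewrite /ucycle /= !inE !(adj2 _ _ ac, adj2 _ _ bc, adj2 _ _ kb', adj2 _ _ xk, adj2 _ _ ax).
  by rewrite !(ne2 _ _ ca', ne2 _ _ ba, ne2 _ _ cb, ne2 _ _ ka, ne2 _ _ kb,
               ne2 _ _ kc, ne2 _ _ kx, ne2 _ _ xa, ne2 _ _ xb, ne2 _ _ xc).
- set e1 := face_next e; set e2 := face_next e1; set z := dart_head e2.
  set k := face_next (face_next e2) => ke _; have [ka kc kb kb'] := prev k ke.
  have xz : adj x z by rewrite -[x]tail_face_next adj_dart.
  have zk : adj z (tail k).
    by rewrite /k tail_face_next -[z]tail_face_next adj_dart.
  have zx : z != x by apply: contraTneq xz => ->; rewrite adj_irr.
  have kz : tail k != z by apply: contraTneq zk => ->; rewrite adj_irr.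
  have za : z != a.
    by rewrite -[a]/(dart_head e) -(tail_face_next e) head_face_next_neq.
  have kx : tail k != x.
    by rewrite /k tail_face_next -[x]tail_face_next head_face_next_neq.
  have zb : z != b.
    by rewrite -(ends k ke) /z -(tail_face_next e2) eq_sym head_face_next_neq.
  have [zc|zc] := eqVneq z c.
    rewrite zc in xz zk.
    case: no5; apply: (@net_of_chord G a c [:: x] [:: tail k; b]) => //.
    rewrite /ucycle /= !inE !(adj2 _ _ ax, adj2 _ _ xz, adj2 _ _ zk, adj2 _ _ kb', adj2 _ _ ab).
    by rewrite !(ne2 _ _ ca', ne2 _ _ ba, ne2 _ _ cb, ne2 _ _ ka, ne2 _ _ kb,
                 ne2 _ _ kc, ne2 _ _ kx, ne2 _ _ xa, ne2 _ _ xb, ne2 _ _ xc).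
  case: no6; apply: (@net_of_chord G a b [:: c] [:: tail k; z; x]) => //.
  rewrite /ucycle /= !inE !(adj2 _ _ ac, adj2 _ _ bc, adj2 _ _ kb', adj2 _ _ zk,
                            adj2 _ _ xz, adj2 _ _ ax).
  by rewrite !(ne2 _ _ ca', ne2 _ _ ba, ne2 _ _ cb, ne2 _ _ ka, ne2 _ _ kb,
    ne2 _ _ kc, ne2 _ _ kx, ne2 _ _ xa, ne2 _ _ xb, ne2 _ _ xc, ne2 _ _ kz,
    ne2 _ _ za, ne2 _ _ zb, ne2 _ _ zc, ne2 _ _ zx).
Qed.

(** Two triangles across edges of a triangle make, with it, three consecutive
triangular corners at the common end of these edges. *)
Lemma tri_sides d : ~ has_net G 5 -> 4 <= degree (dart_head d) -> tri d ->
  ~~ (tri (rev_dart d) && tri (rev_dart (face_next d))).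
Proof.
move=> no5 d4 td; have := @three_tri_corners (finv s (rev_dart d)) no5.
rewrite -(rot (finv s _)) !(f_finv (@perm_inj _ s)) => /(_ d4).
by rewrite -[s (rev_dart d)]/(face_next d) tri_next td [tri (s _)]tri_rot /=.
Qed.

Definition num_tri_tri : nat := \sum_d (tri d && tri (rev_dart d)).

Lemma num_tri_tri_le : ~ has_net G 5 -> (forall d, 4 <= degree (tail d)) ->
  3 * num_tri_tri <= num_tri.
Proof.
move=> no5 d4; pose F d : nat := tri d && tri (rev_dart d).
have -> : 3 * num_tri_tri = \sum_d (F d + F (face_next d) + F (face_next (face_next d))).
  have e2 : \sum_d F (face_next (face_next d)) = \sum_d F (face_next d).
    exact: (sum_face_next (fun d => F (face_next d))).
  by rewrite !big_split /= e2 sum_face_next !mulSn mul0n addn0 addnA.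
apply: leq_sum => d _; rewrite /F !tri_next; case: (boolP (tri d)) => //= td.
have d4' (z : dart G) : 4 <= degree (dart_head z) by exact: (d4 (rev_dart z)).
have d3 : face_next (face_next (face_next d)) = d.
  by move/eqP: (td) => d3; have := iter_face_size d; rewrite d3.
have := tri_sides no5 (d4' d) td.
have := tri_sides no5 (d4' (face_next d)); rewrite tri_next => /(_ td).
have := tri_sides no5 (d4' (face_next (face_next d))); rewrite !tri_next d3 => /(_ td).
by do 3!case: (tri (rev_dart _)).
Qed.

(** Faces other than triangles that border a triangle have length at least 6, and
can afford to give one unit of their weight across each edge that they share with
a triangle; only pairs of adjacent triangles are left with a deficit. *)
Lemma faces_le_no6 : ~ has_net G 5 -> ~ has_net G 6 ->
  12 * fcard face_next predT <= 3 * #|dart G| + num_tri_tri.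
Proof.
move=> no5 no6; pose give d : nat := ~~ tri d && tri (rev_dart d).
pose w d := 3 + tri d - give d.
have wE d : w d + give d = 3 + tri d by rewrite /w /give; case: (tri d); case: tri.
have -> : 3 * #|dart G| + num_tri_tri = \sum_d w d.
  have : \sum_d w d + \sum_d give d = 3 * #|dart G| + num_tri.
    rewrite -big_split /= (eq_bigr (fun d => 3 + tri d)) => [|d _]; last exact: wE.
    by rewrite big_split /= sum_nat_const mulnC.
  have -> : num_tri = num_tri_tri + \sum_d give d.
    have -> : \sum_d give d = \sum_d (tri d && ~~ tri (rev_dart d) : nat).
      rewrite (reindex_inj (@rev_dart_inj G)); apply: eq_bigr => d _.
      by rewrite /give rev_dartK andbC.
    rewrite -big_split; apply: eq_bigr => d _ /=.
    by case: (tri d); case: tri.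
  by rewrite addnA => /addIn.
apply: face_weights => d.
(* c bounds the weight of each dart of the face from below: a face of length 4
   or 5 gives nothing away, and a longer one at most 1 per dart. *)
pose c := if face_size d == 3 then 4 else if face_size d < 6 then 3 else 2.
apply: (@leq_trans (face_size d * c)).
  rewrite /c; move: (face_size d) (face_size_ge3 d) => n.
  by clear; case: eqP => [-> //|]; case: (ltnP n 6); lia.
rewrite -sum_nat_const; apply: leq_sum => d' /face_size_connect dd'.
have td' : tri d' = (face_size d == 3) by rewrite /tri dd'.
rewrite /c /w /give; case: eqP => d3.
  by rewrite td' d3 eqxx.
move/eqP/negPf: d3 => d3; rewrite td' d3 /=; case: ltnP => // lt6; last by case: tri.
case: (boolP (tri _)) => // t'; have := face_across_tri no5 no6 t'.
by rewrite rev_dartK td' d3 -dd' leqNgt lt6 => /(_ isT).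
Qed.

End Faces.
(** * Euler's formula and discharging *)

Lemma card_dart (G : sgraph) : #|dart G| = 2 * #|edges G|.
Proof.
rewrite -[#|dart G|]sum1_card (partition_big (@dart_edge G) [in edges G]) /=.
  rewrite mulnC -sum_nat_const; apply: eq_bigr => e /edge_dart[d <-].
  rewrite sum1dep_card -(_ : #|[set d; rev_dart d]| = 2).
    apply: eq_card => d'; rewrite !inE; apply/eqP/orP => [/esym/dart_edge_eq[]->|].
    - by left.
    - by right.
    - by case=> /eqP->; rewrite ?dart_edge_rev.
  by rewrite cards2 eq_sym rev_dart_neq.
by move=> d _; rewrite mem_edges adj_dart.
Qed.

Lemma sum_degree (G : sgraph) : \sum_(v : G) degree v = 2 * #|edges G|.
Proof.
rewrite -card_dart -sum1_card sum_by_tail; apply: eq_bigr => v _.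
by rewrite sum_const_at mul1n.
Qed.

Lemma sum_pred_card (T : finType) (P : pred T) :
  \sum_x (P x : nat) = #|[set x | P x]|.
Proof.
rewrite -sum1dep_card [RHS]big_mkcond; apply: eq_bigr => x _.
by case: (P x).
Qed.

Lemma connect_isolated (G : sgraph) (x y : G) :
  degree x = 0 -> connect (@adj G) x y -> y = x.
Proof.
move=> dx /connectP[[|z p] /= + ->//]; case/andP => xz _.
have : 0 < degree x by rewrite card_gt0; apply/set0Pn; exists z; rewrite inE.
by rewrite dx.
Qed.

(** Isolated vertices satisfy Euler's formula by themselves; removing them
leaves at least one component as soon as there is an edge. *)
Lemma euler_lt (G : sgraph) (s : {perm dart G}) :
    #|G| + num_faces s = #|edges G| + 2 * n_comp (@adj G) predT ->
    edges G != set0 ->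
  #|edges G| < #|[set x : G | degree x != 0]| + fcard (face_next s) predT.
Proof.
rewrite /num_faces => euler /set0Pn[_ /edge_dart[d _]].
have a_sym : connect_sym (@adj G) by apply: sym_connect_sym; apply: adj_sym.
have comps : #|[set x : G | degree x == 0]| < n_comp (@adj G) predT.
  set I := [set x : G | _]; pose r := fingraph.root (@adj G) (tail d).
  have rI : r \notin I.
    rewrite inE; apply/eqP => r0; have := connect_root (@adj G) (tail d).
    rewrite a_sym => /(connect_isolated r0) E.
    by have := degree_neq0 d; rewrite E -/r r0.
  have <- : #|r |: I| = #|I|.+1 by rewrite cardsU1 rI.
  apply: subset_leq_card; apply/subsetP => x; rewrite !inE andbT.
  case/orP=> [/eqP->|/eqP x0]; first exact: roots_root.
  by apply/eqP; apply: connect_isolated x0 (connect_root _ _).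
have VE : #|G| = #|[set x : G | degree x == 0]| + #|[set x : G | degree x != 0]|.
  rewrite -(cardC [set x : G | degree x == 0]); congr (_ + _).
  by apply: eq_card => x; rewrite !inE.
move: euler comps VE; rewrite -[fcard (face_next s) _]/(fcard (s \o @rev_dart G) predT).
by clear; set f := n_comp _ _; set c := n_comp _ _; lia.
Qed.

Section Discharging.

Variable G : sgraph.
Hypotheses (G_planar : planar G) (G_no5 : ~ has_net G 5) (G_edge : edges G != set0).

Lemma tri_adj (s : {perm dart G}) d : rotation_system s -> tri s d ->
  [/\ adj (tail d) (tail (face_next s d)),
      adj (tail (face_next s d)) (tail (face_next s (face_next s d))) &
      adj (tail (face_next s (face_next s d))) (tail d)].
Proof.
move=> s_rot td; rewrite -{2}(tri_third s_rot td) !(tail_face_next s_rot).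
by split; [|rewrite -(tail_face_next s_rot d)|rewrite -(tail_face_next s_rot (face_next s d))];
  apply: adj_dart.
Qed.

Lemma discharge_large D : 7 <= D ->
    (forall x : G, degree x <= D) ->
    (forall x y : G, adj x y -> D + 3 <= degree x + degree y) ->
  #|[set x : G | degree x == D]| < #|[set x : G | degree x == 3]|.
Proof.
move=> D7 maxD sumD; rewrite ltnNge; apply/negP => le3.
case: G_planar => s s_rot /euler_lt/(_ G_edge) euler.
have deg3 (d : dart G) : 3 <= degree (tail d).
  have := sumD _ _ (adj_dart d); have := maxD (dart_head d); lia.
have faces := faces_le s_rot deg3; rewrite card_dart in faces.
(* h is six times what a vertex gives to each of its triangles. *)
pose h (v : G) := if degree v <= 4 then 0 else if degree v == 5 then 2 else 3.
have weight : 6 * num_tri s <= 3 * \sum_(v : G) h v * tri_at s v.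
  apply: tri_weight => // d /(tri_adj s_rot)[/sumD + /sumD + /sumD].
  set a := tail d; set b := tail _; set c := tail _; rewrite /h.
  move: (degree a) (degree b) (degree c) (maxD a) (maxD b) (maxD c) D7; clear.
  move=> x y z; do ?case: ifP => ?; lia.
(* Six times the condition that a vertex pays its triangles out of deg v - 4 and
   keeps one unit if its degree is D, a vertex of degree 3 borrowing one unit. *)
have vertices : \sum_(v : G) h v * tri_at s v
    + 24 * #|[set x : G | degree x != 0]| + 6 * #|[set x : G | degree x == D]|
    <= 6 * (2 * #|edges G|) + 6 * #|[set x : G | degree x == 3]|.
  rewrite -sum_degree -!sum_pred_card !big_distrr -!big_split /=.
  apply: leq_sum => v _.
  have t1 : tri_at s v <= degree v.
    rewrite -[degree v]mul1n -sum_const_at; apply: leq_sum => d _; exact: leq_b1.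
  have t2 : 4 <= degree v -> 3 * tri_at s v <= 2 * degree v by apply: tri_at_no5.
  have n12 : degree v != 1 /\ degree v != 2.
    have [d dv|none] := pickP [pred d | tail d == v].
      by have := deg3 d; rewrite (eqP dv); case: (degree v) => [|[|[|]]].
    rewrite -card_darts_at; suff -> : [set d | tail d == v] = set0 by rewrite cards0.
    by apply/setP => d; rewrite !inE; apply: none.
  rewrite /h; move: (degree v) (tri_at s v) (maxD v) t1 t2 n12 D7; clear.
  move=> x t; case: ifP => h1; [|case: ifP => h2]; do 3!case: eqP => ? /=; lia.
move: euler faces weight vertices le3; clear.
by set f := n_comp _ _; lia.
Qed.

Lemma discharge_small :
    (forall x : G, degree x <= 5) ->
    (forall x y : G, adj x y -> 9 <= degree x + degree y) ->
  has_net G 4 /\ has_net G 6.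
Proof.
move=> max5 sum9.
case: G_planar => s s_rot /euler_lt/(_ G_edge) euler.
have deg4 (d : dart G) : 4 <= degree (tail d).
  have := sum9 _ _ (adj_dart d); have := max5 (dart_head d); lia.
have deg3 (d : dart G) : 3 <= degree (tail d) by apply: ltnW.
have degs (v : G) : [\/ degree v = 0 /\ tri_at s v = 0, degree v = 4 | degree v = 5].
  have t1 : tri_at s v <= degree v.
    rewrite -[degree v]mul1n -sum_const_at; apply: leq_sum => d _; exact: leq_b1.
  have [d dv|none] := pickP [pred d | tail d == v].
    have := deg4 d; rewrite (eqP dv); have := max5 v.
    by case: (degree v) => [|[|[|[|[|[|]]]]]] // _ _; [apply: Or32|apply: Or33].
  have d0 : degree v = 0.
    rewrite -card_darts_at; apply/eqP; rewrite cards_eq0; apply/eqP/setP => d.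
    by rewrite !inE; apply: none.
  by apply: Or31; split=> //; apply/eqP; rewrite -leqn0 -d0.
(* A vertex of degree 5 gives k to each of its triangles, counted in sixths of a
   unit when k = 3 and in thirds when k = 1. *)
have weight k : 2 * k * num_tri s <=
    3 * \sum_(v : G) (if degree v == 5 then k else 0) * tri_at s v.
  apply: tri_weight => // d /(tri_adj s_rot)[/sum9 + /sum9 + /sum9].
  set a := tail d; set b := tail _; set c := tail _.
  move: (degree a) (degree b) (degree c) (max5 a) (max5 b) (max5 c); clear.
  move=> x y z; do 3!case: eqP => ?; lia.
have faces := faces_le s_rot deg3; rewrite card_dart in faces.
split; apply: contrapT => no.
  have vertices : \sum_(v : G) (if degree v == 5 then 3 else 0) * tri_at s v
      + 24 * #|[set x : G | degree x != 0]| <= 6 * (2 * #|edges G|).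
    rewrite -sum_degree -!sum_pred_card !big_distrr -!big_split /=.
    apply: leq_sum => v _; have := tri_at_no4 s_rot deg3 v no.
    by case: (degs v) => [[-> ->]|->|->] //=; lia.
  have := weight 3; move: euler faces vertices; clear.
  by set f := n_comp _ _; lia.
have vertices : \sum_(v : G) (if degree v == 5 then 1 else 0) * tri_at s v
    + 12 * #|[set x : G | degree x != 0]| <= 3 * (2 * #|edges G|).
  rewrite -sum_degree -!sum_pred_card !big_distrr -!big_split /=.
  apply: leq_sum => v _; have := @tri_at_no5 _ _ s_rot deg3 v G_no5.
  by case: (degs v) => [[-> ->]|->|->] //=; lia.
have faces6 := faces_le_no6 s_rot deg3 G_no5 no; rewrite card_dart in faces6.
have := num_tri_tri_le s_rot deg3 G_no5 deg4.
have := weight 1; move: euler faces6 vertices; clear.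
by set f := n_comp _ _; lia.
Qed.

End Discharging.
(** * Choosability of planar graphs without 5-nets *)

Lemma group_choosable_line_graph (G : sgraph) k :
  edge_choosable k (edges G) -> group_choosable (line_graph G) k.
Proof.
move=> ch A _ L cardL o [o_adj o_asym] f.
pose l (u : edge G) := sval (boolp.cid (card_eq_seq (cardL u))).
have lP u : [/\ uniq (l u), size (l u) = k & forall a, a \in l u -> L u a].
  exact: (svalP (boolp.cid (card_eq_seq (cardL u)))).
pose h (u v : line_graph G) : A :=
  if insub [set u; v] is Some z then f z else 0%R.
pose g e1 e2 : A := match insub e1 : option (edge G), insub e2 : option (edge G) with
  | Some u, Some v => if o u v then h u v else (- h u v)%R
  | _, _ => 0%R
  end.
pose L' e := if insub e is Some u then l u else [::].
have [||c [cL cP]] := ch A g L'.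
- move=> e1 e2 m12; rewrite /g; case: insubP => [u _ ue|_]; case: insubP => [v _ ve|_];
    rewrite ?GRing.oppr0 //.
  have uv : adj (u : line_graph G) v.
    by rewrite touches_sym in m12; rewrite /= /line_adj -val_eqE ue ve; exact: m12.
  rewrite (o_asym _ _ uv) /h [[set v; u]]setUC.
  by case: (o v u); rewrite ?GRing.opprK.
- move=> e eE; rewrite /L'; case: insubP => [u _ _|]; last by rewrite eE.
  by have [ul sl _] := lP u.
exists (fun u => c (val u)); split=> [u|e u v euv ouv].
  have [_ _] := lP u; apply; have := cL _ (valP u).
  by rewrite /L' valK.
have uv := o_adj _ _ ouv.
have muv : touches (val u) (val v) by rewrite /touches val_eqE.
move=> E; apply: (cP _ _ (valP u) (valP v) muv).
by rewrite /g !valK ouv /h -euv valK -E GRing.addrC GRing.subrK.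
Qed.

(** Induction on the number of edges. In a graph that is not choosable although
all its proper subgraphs are, every edge meets at least [k] others, since it could
otherwise be coloured last. *)
Lemma edge_choosable_minimal k (P : sgraph -> Prop) :
    (forall (G : sgraph) (U : {set {set G}}), U \subset edges G -> P G -> P (del U)) ->
    (forall G, P G -> edges G != set0 ->
       (forall x y : G, adj x y -> k + 2 <= degree x + degree y) ->
       (forall U : {set {set G}}, U \subset edges G -> U != set0 ->
          edge_choosable k (edges G :\: U)) ->
       ~ edge_choosable k (edges G) -> False) ->
  forall G, P G -> edge_choosable k (edges G).
Proof.
move=> Pdel Pmin G; have [n] := ubnP #|edges G|; elim: n G => // n IHn G leG PG.
apply: contrapT => notC.
have IH (U : {set {set G}}) : U \subset edges G -> U != set0 ->
    edge_choosable k (edges G :\: U).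
  move=> sU U0; suff : edge_choosable k (edges (del U)) by rewrite edges_del.
  apply: IHn; last exact: Pdel.
  rewrite edges_del -ltnS; apply: leq_trans leG; rewrite ltnS cardsD (setIidPr sU).
  rewrite -card_gt0 in U0.
  by rewrite ltn_subrL U0 (leq_trans U0 (subset_leq_card sU)).
apply: (Pmin G PG) => // [|x y xy].
  apply/eqP => E0; apply: notC; rewrite E0; exact: edge_choosable0.
rewrite leqNgt; apply/negP => lt; apply: notC.
have xyE : [set x; y] \in edges G by rewrite mem_edges.
apply: (reducible_edge xyE).
  by have := card_nbrs (subxx _) xyE; rewrite !card_edges_at; lia.
apply: IH; first by rewrite sub1set.
by apply/set0Pn; exists [set x; y]; rewrite inE.
Qed.

Lemma edge_choosable_large D G : 7 <= D ->
    planar G -> ~ has_net G 5 -> (forall x : G, degree x <= D) ->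
  edge_choosable D.+1 (edges G).
Proof.
move=> D7 pG no5 maxD.
apply: (@edge_choosable_minimal D.+1 (fun G => [/\ planar G, ~ has_net G 5 &
  forall x : G, degree x <= D])) => {G pG no5 maxD} // [G U sU|G] [pG no5 maxD].
  split; first exact: planar_del.
    by move/has_net_del.
  by move=> x; apply: leq_trans (degree_del U x) (maxD x).
move=> E0 sumD minC notC.
have sumD3 (x y : G) : adj x y -> D + 3 <= degree x + degree y.
  by move=> /sumD; rewrite addSn addn2 addn3.
have := card_degree3_le (ltn_trans (isT : 3 < 6) D7) maxD sumD3 minC notC.
by rewrite leqNgt (discharge_large pG no5 E0 D7 maxD sumD3).
Qed.

Lemma edge_choosable_small G :
    planar G -> ~ has_net G 5 -> ~ has_net G 4 \/ ~ has_net G 6 ->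
    (forall x : G, degree x <= 5) ->
  edge_choosable 7 (edges G).
Proof.
move=> pG no5 no46 max5.
apply: (@edge_choosable_minimal 7 (fun G => [/\ planar G, ~ has_net G 5,
  ~ has_net G 4 \/ ~ has_net G 6 & forall x : G, degree x <= 5]))
  => {G pG no5 no46 max5} // [G U sU|G] [pG no5 no46 max5].
  split; first exact: planar_del.
  - by move/has_net_del.
  - by case: no46 => no; [left|right] => /has_net_del.
  - by move=> x; apply: leq_trans (degree_del U x) (max5 x).
move=> E0 sum9 _ _.
have [net4 net6] := discharge_small pG no5 E0 max5 sum9.
by case: no46.
Qed.

Lemma edge_group_choice_number_le (G : sgraph) k :
  edge_choosable k (edges G) -> edge_group_choice_number G <= k.
Proof.
move/group_choosable_line_graph => ch.
rewrite /edge_group_choice_number /group_choice_number; case: ex_minnP => m _.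
by apply; apply/boolp.asboolP.
Qed.

Theorem theorem3p14 (G : sgraph) :
  planar G -> ~ has_net G 5 ->
  (6 <= max_degree G ->
     edge_group_choice_number G <= maxn 8 (max_degree G + 1)) /\
  (max_degree G = 5 -> (~ has_net G 4 \/ ~ has_net G 6) ->
     edge_group_choice_number G <= 7).
Proof.
move=> pG no5.
have max_deg (x : G) : degree x <= max_degree G by apply: leq_bigmax.
split=> [_|D5 no46]; apply: edge_group_choice_number_le.
  have -> : maxn 8 (max_degree G + 1) = (maxn 7 (max_degree G)).+1.
    by rewrite addn1 maxnSS.
  apply: edge_choosable_large => //; first exact: leq_maxl.
  by move=> x; apply: leq_trans (max_deg x) (leq_maxr _ _).
by apply: edge_choosable_small => // x; rewrite -D5.
Qed.
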